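(* For every integer $t\ge 3$, the Strong Ramsey game $\mathcal{R}(K_{\aleph_0}^{(3)}, K^{(3)}_{2,t+1}(t-2))$ is a draw; that is, $P_2$ has a strategy guaranteeing that $P_1$ never claims all edges of a copy of $K^{(3)}_{2,t+1}(t-2)$.
   Context: Strong Ramsey game $\mathcal{R}(B,G)$: $B$ (possibly infinite) and $G$ (finite) are $k$-uniform hypergraphs; players $P_1$ and $P_2$ alternately claim a previously unclaimed edge of $B$, $P_1$ first; the first to claim all edges of a copy of $G$ in $B$ wins; if neither does so after finitely many moves, the game is a draw. $K_{\aleph_0}^{(3)}$ is the complete $3$-uniform hypergraph on a countably infinite vertex set. For $s\ge0$, $t\ge3$, $K_{2,t}(s)$ is the graph obtained from $K_{2,t}$ by identifying the center of a star with $s$ leaves (the leaves being new vertices) with one of the two vertices of degree $t$. For a graph $H$, $H^{(3)}$ is the $3$-uniform hypergraph obtained by adding one fixed new vertex (the center) to every edge of $H$. *)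

(* Defs.v *)
From HB Require Import structures.
From mathcomp Require Import all_boot all_order.
From mathcomp Require Import finmap.

Set Implicit Arguments.
Unset Strict Implicit.
Unset Printing Implicit Defensive.

Local Open Scope fset_scope.

(* The graph K_{2,t}(s) on the vertex set 'I_(t+s+2):
   vertex 0 and vertex 1 are the two vertices of K_{2,t} of degree t,
   vertices 2 .. t+1 are the t common neighbours,
   vertices t+2 .. t+s+1 are the s leaves of the star whose centre is
   identified with vertex 0.  Edges are 2-element sets. *)
Definition K2ts_edges (t s : nat) : {set {set 'I_(t + s + 2)}} :=
  [set e : {set 'I_(t + s + 2)} |
    [exists i : 'I_(t + s + 2), exists j : 'I_(t + s + 2),
      (e == [set i; j]) &&
      ((((nat_of_ord i == 0) || (nat_of_ord i == 1)) && (2 <= j < t + 2))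
       || ((nat_of_ord i == 0) && (t + 2 <= j)))]].

Definition cone3 (V : finType) (E : {set {set V}}) : {set {set option V}} :=
  imset (fun e : {set V} => setU [set None] (imset (@Some V) (mem e))) (mem E).

Definition hyp_image (U : choiceType) (V : finType) (f : V -> U) (e : {set V})
  : {fset U} := [fset f x | x in enum e].

Definition contains_copy (U : choiceType) (V : finType) (E : {set {set V}})
  (S : seq {fset U}) : Prop :=
  exists f : V -> U, injective f /\ forall e, e \in E -> hyp_image f e \in S.

Definition strategy (U : choiceType) := seq {fset U} -> {fset U}.

Definition legal_strategy (U : choiceType) (BE : pred {fset U})
  (sigma : strategy U) : Prop :=
  forall h : seq {fset U}, BE (sigma h) /\ sigma h \notin h.

(* A play is the infinite sequence of moves p 0, p 1, ...;
   P1 makes the moves p (2i), P2 the moves p (2i+1). *)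
Definition history (U : choiceType) (p : nat -> {fset U}) (n : nat) :=
  [seq p i | i <- iota 0 n].
Definition P1_moves (U : choiceType) (p : nat -> {fset U}) (n : nat) :=
  [seq p (2 * i) | i <- iota 0 n].
Definition P2_moves (U : choiceType) (p : nat -> {fset U}) (n : nat) :=
  [seq p (2 * i).+1 | i <- iota 0 n].

Definition consistent_P2 (U : choiceType) (BE : pred {fset U})
  (sigma : strategy U) (p : nat -> {fset U}) : Prop :=
  (forall i, BE (p i)) /\ injective p /\
  (forall n, p (2 * n).+1 = sigma (history p (2 * n).+1)).

(* P1 wins the play: after his (n+1)-th move he owns a copy of G, while P2
   did not own a copy before (otherwise the game would already have ended). *)
Definition P1_wins (U : choiceType) (V : finType) (E : {set {set V}})
  (p : nat -> {fset U}) : Prop :=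
  exists n, contains_copy E (P1_moves p n.+1) /\ ~ contains_copy E (P2_moves p n).

Definition P2_prevents_P1 (U : choiceType) (BE : pred {fset U})
  (V : finType) (E : {set {set V}}) : Prop :=
  exists sigma : strategy U, legal_strategy BE sigma /\
    forall p, consistent_P2 BE sigma p -> ~ P1_wins E p.

Definition K_aleph0_3 : pred {fset nat} := fun e => #|` e| == 3.

(* Main.v *)
Require Import Defs.
From HB Require Import structures.
From mathcomp Require Import all_boot all_order.
From mathcomp Require Import finmap.
From mathcomp Require Import zify.
From Stdlib Require Import ClassicalEpsilon.

(** P2 first builds a star of [2t-1] edges [{p,q,x}] avoiding the first edge
    [e0] of P1, and then, with a fresh vertex [b] and a centre [c] chosen in
    [{p,q}] (call [a] the other vertex), claims edges [{c,b,x}] over the leaves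
    of the star.  Owning [t+1] of these wins.  If P1 spends his moves on blocking
    them, P2 still gets [t], and from then on he plays [{c,a,y}] with [y] fresh
    for ever: each such move threatens [{c,b,y}], and the forced answers do not
    help P1.

    When P2 plays his first edge [{c,b,x}], P1 owns a set [D] of [2t] edges.
    Call an edge local for [k], [u], [v] if it contains [k] and exactly one of
    [u], [v]; all edges of a copy are local for suitable [k], [u], [v].  If [D]
    has a non-local edge for every such triple, then every copy misses an edge
    of [D], so P1 is too slow to ignore P2, and it suffices to choose [c] so
    that few edges of [D] contain [c] but not [a].  If [D] is local for some
    triple, then [k] and one of [u], [v] lie in [e0], so [c] can be chosen
    outside [{k,u,v}] and blocking P2 does not help P1 locally.  The exchange
    of [u] and [v] pairs the local edges; with this pairing P2 answers local
    moves so that P1 never owns both edges of more than [t] pairs, while every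
    non-local move of P1 gives P2 a move in the race. *)

Set Implicit Arguments.
Unset Strict Implicit.
Unset Printing Implicit Defensive.

(** * Triples as edges, and copies described by the roles of their vertices *)

Definition tri (x y z : nat) : {fset nat} := [fset x; y; z]%fset.

Lemma in_tri v x y z : (v \in tri x y z) = [|| v == x, v == y | v == z].
Proof. by rewrite /tri !inE orbA. Qed.

Lemma triCl x y z : tri x y z = tri y x z.
Proof. by apply/fsetP => v; rewrite !in_tri; do !case: eqP. Qed.

Lemma triCr x y z : tri x y z = tri x z y.
Proof. by apply/fsetP => v; rewrite !in_tri; do !case: eqP. Qed.

Lemma tri_inj x y z w : z != x -> z != y -> tri x y z = tri x y w -> z = w.
Proof.
move=> zx zy /fsetP /(_ z); rewrite !in_tri (negPf zx) (negPf zy) eqxx /=.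
by move/esym/eqP.
Qed.

Lemma card_tri x y z : x != y -> x != z -> y != z -> (#|` tri x y z| == 3)%fset.
Proof.
move=> xy xz yz.
have -> : tri x y z = (z |` [fset x; y])%fset by apply/fsetP => v; rewrite in_tri !inE orbA orbC.
by rewrite cardfsU1 !inE cardfs2 xy ![z == _]eq_sym (negPf xz) (negPf yz).
Qed.

(* The roles in a copy: [z] is the centre, [al] and [be] are the vertices of
   degree [2t-1] and [t+1] in the link of [z], [X] are their common neighbours
   and [L] the leaves at [al]. *)
Definition copy_at (t z al be : nat) (X L : seq nat) (S : seq {fset nat}) :=
  [/\ uniq (z :: al :: be :: X ++ L), size X = t.+1, size L = t - 2,
      {in X ++ L, forall x, tri z al x \in S} &
      {in X, forall x, tri z be x \in S}].

Definition copy t S := exists z al be X L, copy_at t z al be X L S.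

Lemma copy_sub t S S' : {subset S <= S'} -> copy t S -> copy t S'.
Proof.
move=> sS [z [al [be [X [L [U sX sL H1 H2]]]]]]; exists z, al, be, X, L.
by split=> // x xX; apply: sS; [apply: H1 | apply: H2].
Qed.

Lemma hyp_image_cone (V : finType) (f : option V -> nat) (i j : V) :
  hyp_image f (setU [set None] (imset (@Some V) (mem [set i; j])))
  = tri (f None) (f (Some i)) (f (Some j)).
Proof.
apply/fsetP=> v; rewrite in_tri; apply/imfsetP/idP => /=.
  case=> x; rewrite mem_enum in_setU in_set1 => /orP [/eqP -> ->|]; first by rewrite eqxx.
  case/imsetP => y; rewrite !inE => /orP [] /eqP -> -> ->; by rewrite eqxx ?orbT.
case/or3P=> /eqP ->.
- by exists None => //; rewrite mem_enum in_setU in_set1 eqxx.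
- by exists (Some i) => //; rewrite mem_enum in_setU imset_f ?orbT // !inE eqxx.
- by exists (Some j) => //; rewrite mem_enum in_setU imset_f ?orbT // !inE eqxx orbT.
Qed.

(** From here on copies are handled by roles: the cone vertex [None] becomes the centre, vertices 0
    and 1 become [al] and [be], and then come the common neighbours and the leaves. *)
Lemma contains_copyE t S : 3 <= t ->
  contains_copy (cone3 (K2ts_edges t.+1 (t - 2))) S <-> copy t S.
Proof.
move=> ht; split.
- case=> f [finj H].
  have E (i j : 'I_(t.+1 + (t - 2) + 2)) :
    (((nat_of_ord i == 0) || (nat_of_ord i == 1)) && (2 <= j < t.+1 + 2))
       || ((nat_of_ord i == 0) && (t.+1 + 2 <= j)) ->
    tri (f None) (f (Some i)) (f (Some j)) \in S.
    move=> Hij; rewrite -hyp_image_cone; apply: H; apply: imset_f.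
    by rewrite inE; apply/existsP; exists i; apply/existsP; exists j; rewrite eqxx.
  have pn : 0 < t.+1 + (t - 2) + 2 by lia.
  (* Indexing by [nat] turns the roles into intervals; below the bound the default value of [insubd]
     is never taken. *)
  pose h (i : nat) := f (Some (insubd (Ordinal pn) i)).
  have vh i : i < t.+1 + (t - 2) + 2 -> val (insubd (Ordinal pn) i) = i.
    by move=> hi; rewrite val_insubd hi.
  have hinj : {in iota 0 (t.+1 + (t - 2) + 2) &, injective h}.
    move=> i j; rewrite !mem_iota !add0n => /= hi hj /finj [] /(congr1 val).
    by rewrite !vh.
  exists (f None), (h 0), (h 1), [seq h i | i <- iota 2 t.+1],
    [seq h i | i <- iota (t.+1 + 2) (t - 2)].
  split; rewrite ?size_map ?size_iota //.
  + rewrite -map_cat [t.+1 + 2]addnC -iotaD.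
    have -> : h 0 :: h 1 :: [seq h i | i <- iota 2 (t.+1 + (t - 2))] =
      [seq h i | i <- iota 0 (t.+1 + (t - 2) + 2)] by rewrite [_ + 2]addnC.
    rewrite cons_uniq map_inj_in_uniq // iota_uniq andbT.
    by apply/mapP => -[i _ /finj].
  + move=> x; rewrite mem_cat => /orP [] /mapP [i]; rewrite mem_iota => hi ->;
      apply: E; rewrite !vh; lia.
  + move=> x /mapP [i]; rewrite mem_iota => hi ->; apply: E; rewrite !vh; lia.
- case=> z [al [be [X [L [U sX sL H1 H2]]]]].
  pose W := al :: be :: X ++ L.
  have sW : size W = t.+1 + (t - 2) + 2 by rewrite /W /= size_cat; lia.
  have uW : uniq W by move: U; rewrite cons_uniq => /andP [].
  have zW : z \notin W by move: U; rewrite cons_uniq => /andP [].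
  pose f (o : option 'I_(t.+1 + (t - 2) + 2)) :=
    if o is Some i then nth 0 W i else z.
  exists f; split.
    move=> [i|] [j|] //=.
    - move/eqP; rewrite nth_uniq ?sW ?ltn_ord // => /eqP ij.
      by congr Some; apply: val_inj.
    - by move=> E; case/negP: zW; rewrite -E mem_nth // sW.
    - by move=> E; case/negP: zW; rewrite E mem_nth // sW.
  move=> e /imsetP [e']; rewrite inE => /existsP [i /existsP [j /andP [/eqP -> Hij]]] ->.
  rewrite hyp_image_cone /=.
  have hj : j < t.+1 + (t - 2) + 2 := ltn_ord j.
  case/orP: Hij => /andP [].
  + case: (nat_of_ord j) hj => [|[|j']] //= hj.
    move=> Hi Hj; rewrite nth_cat sX (_ : j' < t.+1); last by lia.
    have xX : nth 0 X j' \in X by rewrite mem_nth // sX; lia.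
    case/orP: Hi => /eqP ->; [apply: H1 | apply: H2] => //; by rewrite mem_cat xX.
  + case: (nat_of_ord j) hj => [|[|j']] /= hj; rewrite ?addn2 //.
    + by move=> _ Hj; exfalso; lia.
    move=> /eqP -> Hj /=; apply: H1; apply: mem_nth.
    by rewrite size_cat sX sL; lia.
Qed.

(** * Fresh vertices, and reduction of strategies to an invariant of positions *)

Lemma edges_bounded (s : seq {fset nat}) :
  exists N, forall e, e \in s -> forall v : nat, v \in e -> v < N.
Proof.
have bd (r : seq nat) : exists N, forall v, v \in r -> v < N.
  elim: r => [|w r [N HN]]; first by exists 0.
  exists (N + w.+1) => v; rewrite in_cons => /orP [/eqP ->|/HN]; by lia.
elim: s => [|e s [N HN]]; first by exists 0.
have [M HM] := bd (enum_fset e).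
exists (N + M) => e'; rewrite in_cons => /orP [/eqP -> v /HM|/HN h v /h]; by lia.
Qed.

(** [Inv] describes positions with P1 to move, the edges of each player listed latest first. Once P2
    owns a copy the invariant may be dropped, because P1 can no longer be first. *)
Lemma P2_prevents_P1_of_invariant t (Inv : seq {fset nat} -> seq {fset nat} -> Prop) :
  3 <= t -> Inv [::] [::] ->
  (forall s1 s2 e, Inv s1 s2 -> uniq (e :: s1 ++ s2) ->
     all K_aleph0_3 (e :: s1 ++ s2) ->
     ~ copy t (e :: s1) /\
     exists e', [/\ K_aleph0_3 e', e' \notin e :: s1 ++ s2 &
       Inv (e :: s1) (e' :: s2) \/ copy t (e' :: s2)]) ->
  P2_prevents_P1 K_aleph0_3 (cone3 (K2ts_edges t.+1 (t - 2))).
Proof.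
move=> ht Inv0 step.
(* A strategy sees only the history, so the edges of the players are recovered from its even and odd
   positions. *)
pose ev (h : seq {fset nat}) :=
  rev [seq nth fset0 h (2 * i) | i <- iota 0 (uphalf (size h))].
pose od (h : seq {fset nat}) :=
  rev [seq nth fset0 h (2 * i).+1 | i <- iota 0 (size h)./2].
pose good (h : seq {fset nat}) (e' : {fset nat}) := Inv (ev h) (e' :: od h) \/ copy t (e' :: od h).
(* Legality is demanded after every history, a good reply only where one exists. Such a reply
   therefore always exists, and choice yields [sigma]. *)
pose spec (h : seq {fset nat}) (e' : {fset nat}) := [/\ K_aleph0_3 e', e' \notin h &
  (exists e'', [/\ K_aleph0_3 e'', e'' \notin h & good h e'']) -> good h e'].
have spec_ex h : exists e', spec h e'.
  case: (classic (exists e'', [/\ K_aleph0_3 e'', e'' \notin h & good h e''])).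
    by case=> e'' [H1 H2 H3]; exists e''.
  move=> no; have [N HN] := edges_bounded h.
  exists (tri N N.+1 N.+2); split=> //.
    by rewrite /K_aleph0_3 card_tri //; lia.
  apply/negP => /HN /(_ N); rewrite in_tri eqxx => /(_ isT); lia.
pose sigma h := proj1_sig (constructive_indefinite_description _ (spec_ex h)).
have sigmaP h : spec h (sigma h) by rewrite /sigma; case: constructive_indefinite_description.
exists sigma; split=> [h|p [pK [pinj pcons]]]; first by case: (sigmaP h).
have nth_h n i : i < n -> nth fset0 (history p n) i = p i.
  by move=> hi; rewrite (nth_map 0) ?size_iota // nth_iota.
have evE n : ev (history p (2 * n).+1) = p (2 * n) :: rev (P1_moves p n).
  rewrite /ev size_map size_iota.
  have -> : uphalf (2 * n).+1 = n.+1 by lia.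
  rewrite -[n.+1]addn1 iotaD map_cat rev_cat /= add0n.
  rewrite (nth_h (2 * n).+1) //; congr (_ :: rev _).
  by apply/eq_in_map => i; rewrite mem_iota => hi; rewrite nth_h //; lia.
have odE n : od (history p (2 * n).+1) = rev (P2_moves p n).
  rewrite /od size_map size_iota.
  have -> : ((2 * n).+1)./2 = n by lia.
  congr (rev _).
  by apply/eq_in_map => i; rewrite mem_iota => hi; rewrite nth_h //; lia.
have mem_h n x : (x \in history p (2 * n).+1) =
    (x \in p (2 * n) :: rev (P1_moves p n) ++ rev (P2_moves p n)).
  rewrite [in RHS]in_cons mem_cat !mem_rev; apply/mapP/or3P.
    case=> i; rewrite mem_iota => hi ->.
    case: (ltngtP i (2 * n)) => [hi'|hi'|->]; [|lia|by constructor 1].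
    case: (boolP (odd i)) => oi.
      constructor 3; apply/mapP; exists i./2; first by rewrite mem_iota; lia.
      congr p; lia.
    constructor 2; apply/mapP; exists i./2; first by rewrite mem_iota; lia.
    congr p; lia.
  case=> [/eqP ->|/mapP [i]|/mapP [i]].
  - by exists (2 * n) => //; rewrite mem_iota; lia.
  - by rewrite mem_iota => hi ->; exists (2 * i) => //; rewrite mem_iota; lia.
  - by rewrite mem_iota => hi ->; exists (2 * i).+1 => //; rewrite mem_iota; lia.
have un n : uniq (p (2 * n) :: rev (P1_moves p n) ++ rev (P2_moves p n)).
  have usz : size (history p (2 * n).+1) =
    size (p (2 * n) :: rev (P1_moves p n) ++ rev (P2_moves p n)).
    by rewrite /history /= size_cat !size_rev !size_map !size_iota; lia.
  rewrite (uniq_size_uniq _ (mem_h n)) ?usz //.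
  by rewrite map_inj_uniq ?iota_uniq.
have aK n : all K_aleph0_3 (p (2 * n) :: rev (P1_moves p n) ++ rev (P2_moves p n)).
  by apply/allP => x; rewrite -mem_h => /mapP [i _ ->].
have movesS1 n : p (2 * n) :: rev (P1_moves p n) = rev (P1_moves p n.+1).
  by rewrite /P1_moves -[n.+1]addn1 iotaD map_cat rev_cat.
have movesS2 n : p (2 * n).+1 :: rev (P2_moves p n) = rev (P2_moves p n.+1).
  by rewrite /P2_moves -[n.+1]addn1 iotaD map_cat rev_cat.
(* The second alternative records a [k] such that P2 owns a copy after [k] moves and P1 none after
   as many. It persists as [n] grows and excludes a win of P1, both for [k <= n] and for
   [k = n.+1]. *)
have key n : (Inv (rev (P1_moves p n)) (rev (P2_moves p n))
      /\ (0 < n -> ~ copy t (P1_moves p n))) \/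
    (exists k, [/\ k <= n, copy t (P2_moves p k) & ~ copy t (P1_moves p k)]).
  elim: n => [|n [[IH _]|[k [kn H1 H2]]]]; first by left.
    have [ncp [e' [K' ne' He']]] := step _ _ (p (2 * n)) IH (un n) (aK n).
    have ncp' : ~ copy t (P1_moves p n.+1).
      by move=> cp; apply: ncp; apply: copy_sub cp => x; rewrite movesS1 mem_rev.
    have [_ _ gd] := sigmaP (history p (2 * n).+1).
    move: gd; rewrite -pcons /good evE odE movesS1 movesS2 => gd.
    case: gd.
    - exists e'; rewrite mem_h; split=> //.
      by case: He' => He'; [left|right]; rewrite ?movesS1 in He' *.
    - by left.
    - move=> cp; right; exists n.+1; split=> //.
      by apply: copy_sub cp => x; rewrite mem_rev.
  by right; exists k; split=> //; apply: leqW.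
case=> n [/(contains_copyE _ ht) cp1 ncp2].
have {}ncp2 : ~ copy t (P2_moves p n) by move=> cp; apply: ncp2; apply/contains_copyE.
case: (key n.+1) => [[_ /(_ isT)] //|[k [kn H1 H2]]].
have [kn'|kn'] := leqP k n.
  apply: ncp2; apply: copy_sub H1 => x /mapP [i]; rewrite mem_iota => hi ->.
  by apply/mapP; exists i => //; rewrite mem_iota; lia.
by apply: H2; have -> : k = n.+1 by lia.
Qed.

(** * Edges of a copy *)

Ltac decide_eqs :=
  repeat match goal with H : ?a = ?b |- _ => (subst a || subst b) end;
  repeat first
    [ match goal with
      | |- context [?a == ?a] => rewrite (eqxx a)
      | H : is_true (?a != ?b) |- context [?a == ?b] => rewrite (negPf H)
      | H : is_true (?a != ?b) |- context [?b == ?a] => rewrite (eq_sym b a) (negPf H)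
      end
    | progress simpl
    | match goal with
      | |- context [?a == ?b] =>
        let E := fresh "E" in
        case: (eqVneq a b) => [E|E]; first (try subst; try by rewrite eqxx in * )
      end ];
  try done; try congruence; try (by left); try (by right).

Lemma count_le1 (T : eqType) (P : pred T) (a : T) s :
  uniq s -> {in s, forall x, P x -> x = a} -> count P s <= 1.
Proof.
move=> us H; rewrite -size_filter.
apply: (@uniq_leq_size _ _ [:: a]); first exact: filter_uniq.
by move=> x; rewrite mem_filter inE => /andP [Px xs]; rewrite (H x).
Qed.

Lemma count_le2 (T : eqType) (P : pred T) (a b : T) s :
  uniq s -> {in s, forall x, P x -> x = a \/ x = b} -> count P s <= 2.
Proof.
move=> us H; rewrite -size_filter.
apply: (@uniq_leq_size _ _ [:: a; b]); first exact: filter_uniq.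
move=> x; rewrite mem_filter !inE => /andP [Px xs].
by case: (H x xs Px) => ->; rewrite eqxx ?orbT.
Qed.

Lemma count_subset (T : eqType) (P : pred T) s s' :
  uniq s -> {in s, forall x, P x -> x \in s'} -> count P s <= count P s'.
Proof.
move=> us H; rewrite -!size_filter.
apply: uniq_leq_size; first exact: filter_uniq.
by move=> x; rewrite !mem_filter => /andP [Px xs]; rewrite Px H.
Qed.

Definition copy_edges z al be (X L : seq nat) :=
  [seq tri z al x | x <- X ++ L] ++ [seq tri z be x | x <- X].

Section CopyEdges.
Variables (t z al be : nat) (X L : seq nat) (S : seq {fset nat}).
Hypotheses (ht : 3 <= t) (cp : copy_at t z al be X L S).

Lemma copy_roles : [/\ z != al, z != be & al != be].
Proof.
case: cp; rewrite /= !inE !negb_or -!andbA.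
by case/and3P=> -> -> /andP [_ /andP [-> _]].
Qed.

Lemma copy_leaf x : x \in X ++ L -> [/\ x != z, x != al & x != be].
Proof.
move=> xX; case: cp => /= /and4P [] h1 h2 h3 _ _ _ _ _.
split; apply/eqP => E; subst x.
- by move: h1; rewrite !inE xX !orbT.
- by move: h2; rewrite !inE xX !orbT.
- by move: h3; rewrite xX.
Qed.

Lemma copy_common x : x \in X -> [/\ x != z, x != al & x != be].
Proof. by move=> xX; apply: copy_leaf; rewrite mem_cat xX. Qed.

Lemma copy_leaves_uniq : uniq (X ++ L).
Proof. by case: cp => /= /and4P []. Qed.

Lemma copy_common_uniq : uniq X.
Proof. by move: copy_leaves_uniq; rewrite cat_uniq => /and3P []. Qed.

Lemma size_copy_leaves : size (X ++ L) = (2 * t).-1.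
Proof. by case: cp => _ sX sL _ _; rewrite size_cat sX sL; lia. Qed.

Lemma size_copy_edges : size (copy_edges z al be X L) = 3 * t.
Proof.
rewrite size_cat !size_map size_copy_leaves; case: cp => _ -> _ _ _; lia.
Qed.

Lemma copy_edges_uniq : uniq (copy_edges z al be X L).
Proof.
have [zal zbe albe] := copy_roles.
rewrite cat_uniq !map_inj_in_uniq ?copy_leaves_uniq ?copy_common_uniq /=.
- rewrite andbT; apply/hasPn => e /mapP [x xX ->]; apply/mapP => -[y _ /fsetP /(_ al)].
  have [xz xal xbe] := copy_common xX.
  by rewrite !in_tri; decide_eqs.
- move=> x y /copy_common [xz xal xbe] _; exact: tri_inj.
- move=> x y /copy_leaf [xz xal xbe] _; exact: tri_inj.
Qed.

Lemma copy_edges_sub : {subset copy_edges z al be X L <= S}.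
Proof.
case: cp => _ _ _ H1 H2 e; rewrite mem_cat => /orP [] /mapP [x xX ->].
- exact: H1.
- exact: H2.
Qed.

Lemma center_copy_edges e : e \in copy_edges z al be X L -> z \in e.
Proof. by rewrite mem_cat => /orP [] /mapP [x _ ->]; rewrite in_tri eqxx. Qed.

Lemma count_copy_edges P : count P (copy_edges z al be X L) =
  count (fun x => P (tri z al x)) (X ++ L) + count (fun x => P (tri z be x)) X.
Proof. by rewrite /copy_edges [LHS]count_cat !count_map. Qed.

(** Besides the centre only [al] and [be] have large degree: any other [w] lies at most in
    [tri z al w] and [tri z be w]. *)
Lemma count_copy_edges_pair (w : nat) : w != z ->
  2 < count (fun e : {fset nat} => w \in e) (copy_edges z al be X L) ->
  w = al \/ w = be.
Proof.
move=> wz; case: (eqVneq w al) => [|wal]; first by left.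
case: (eqVneq w be) => [|wbe]; first by right.
rewrite ltnNge => /negP []; apply: (@count_le2 _ _ (tri z al w) (tri z be w)).
  exact: copy_edges_uniq.
move=> e; rewrite mem_cat => /orP [] /mapP [x xX ->]; rewrite in_tri.
- by rewrite (negPf wz) (negPf wal) => /eqP ->; left.
- by rewrite (negPf wz) (negPf wbe) => /eqP ->; right.
Qed.

End CopyEdges.

(** * How many edges of a copy are local *)

Definition loc (k u v : nat) (e : {fset nat}) :=
  (k \in e) && ((u \in e) (+) (v \in e)).

Section LocalCount.
Variables (t z al be : nat) (X L : seq nat) (S : seq {fset nat}).
Hypotheses (ht : 3 <= t) (cp : copy_at t z al be X L S).

(** A copy is local for its own roles, so an edge of P1 that is non-local for them is wasted on this
    copy. *)
Lemma copy_edges_loc : {in copy_edges z al be X L, forall e, loc z al be e}.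
Proof.
have [zal zbe albe] := copy_roles cp.
move=> e; rewrite mem_cat => /orP [] /mapP [x xX ->]; rewrite /loc !in_tri.
- by have [? ? ?] := copy_leaf cp xX; decide_eqs.
- by have [? ? ?] := copy_common cp xX; decide_eqs.
Qed.

(** A local edge of the copy contains [z], [k] and one of [u], [v], hence is [tri z k u] or
    [tri z k v]. *)
Lemma count_loc_copy (k u v : nat) : u != k -> v != k -> z \notin [:: k; u; v] ->
  count (loc k u v) (copy_edges z al be X L) <= 2.
Proof.
rewrite !inE !negb_or => uk vk /and3P [zk zu zv].
apply: (@count_le2 _ _ (tri z k u) (tri z k v)); first exact: copy_edges_uniq cp.
have aux1 g x w : w != k -> w != z -> k \in tri z g x -> w \in tri z g x ->
    tri z g x = tri z k w.
  rewrite !in_tri ![_ == z]eq_sym (negPf zk) => wk /negPf -> /=.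
  case: (eqVneq k g) => [<- _ /=|_ /= /eqP <-]; first by rewrite (negPf wk) => /eqP ->.
  by rewrite (negPf wk) orbF => /eqP ->; rewrite triCr.
have aux g x : loc k u v (tri z g x) -> tri z g x = tri z k u \/ tri z g x = tri z k v.
  case/andP=> kin; case: (boolP (u \in tri z g x)) => [uin _|_ /= vin].
  - by left; apply: aux1; rewrite // eq_sym.
  - by right; apply: aux1; rewrite // eq_sym.
by move=> e; rewrite mem_cat => /orP [] /mapP [x xX ->]; apply: aux.
Qed.

(** Enough non-local edges are found in the star at [al], in the star at [be], or in both. The
    assumption [3 <= t] enters when [2t - 2] and [3t - 4] are compared with [t]. *)
Lemma count_nonloc_copy (k u v : nat) : u != k -> v != k -> u != v ->
  ~~ [&& z == k, al \in [:: u; v] & be \in [:: u; v]] ->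
  t < count (predC (loc k u v)) (copy_edges z al be X L).
Proof.
move=> uk vk uv.
have uXL := copy_leaves_uniq cp; have uX := copy_common_uniq cp.
have sXL := size_copy_leaves ht cp; have sX : size X = t.+1 by case: cp.
have nloc P s (n : nat) : count P s <= n -> size s - n <= count (predC P) s.
  by rewrite -(count_predC P s); lia.
have [zal zbe albe] := copy_roles cp.
have star g (Y : seq nat) (a : nat) : uniq Y -> (forall x, x \in Y -> loc k u v (tri z g x) -> x = a) ->
    size Y - 1 <= count (fun x => predC (loc k u v) (tri z g x)) Y.
  by move=> uY HY; apply: nloc; apply: count_le1 uY HY.
have [Ez|zk] := eqVneq z k; last first.
  move=> _; have [zuv|zuv] := boolP (z \in [:: u; v]).
    (* Local edges contain [k]. If [al = k], no edge of the star at [be] does; otherwise, in the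
       star at [al], only the edge over the leaf [k] does. *)
    have [Ea|ak] := eqVneq al k.
      rewrite (count_copy_edges z al be X L).
      suff -> : count (fun x => predC (loc k u v) (tri z be x)) X = size X by lia.
      apply/eqP; rewrite -all_count; apply/allP => x /(copy_common cp) [xz xal xbe].
      by rewrite /= /loc !in_tri; decide_eqs.
    have := star al (X ++ L) k uXL.
    rewrite (count_copy_edges z al be X L) => H.
    have {}H : size (X ++ L) - 1 <= count (fun x => predC (loc k u v) (tri z al x)) (X ++ L).
      by apply: H => x _; rewrite /loc !in_tri; decide_eqs.
    by lia.
  have c2 : count (loc k u v) (copy_edges z al be X L) <= 2.
    by apply: count_loc_copy => //; move: zuv; rewrite !inE; decide_eqs.
  by have := nloc _ _ _ _ c2; rewrite (size_copy_edges ht cp); lia.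
rewrite (count_copy_edges z al be X L).
have [al_uv|al_uv] := boolP (al \in [:: u; v]) => be_uv; rewrite /= in be_uv.
  (* [o] is the member of [{u,v}] other than [al]. An edge [tri z be x] is local only for [x = o];
     if [o] is in [X], this loss is made up by [tri z al o], which contains both [u] and [v]. *)
  have [o Eo] : exists o, (al = u /\ o = v) \/ (al = v /\ o = u).
    by move: al_uv; rewrite !inE => /orP [] /eqP ->; [exists v; left|exists u; right].
  have star_be := star be X o uX.
  have {}star_be : size X - 1 <= count (fun x => predC (loc k u v) (tri z be x)) X.
    apply: star_be => x /(copy_common cp) [xz xal xbe]; move: be_uv; case: Eo => -[? ?];
      by rewrite /loc !in_tri !inE; decide_eqs.
  have [oX|oX] := boolP (o \in X).
    suff c1 : 0 < count (fun x => predC (loc k u v) (tri z al x)) (X ++ L).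
      by apply: leq_trans (leq_add c1 star_be); rewrite sX; lia.
    rewrite -has_count; apply/hasP; exists o; first by rewrite mem_cat oX.
    by case: Eo => -[? ?]; rewrite /= /loc !in_tri; decide_eqs.
  suff -> : count (fun x => predC (loc k u v) (tri z be x)) X = size X by lia.
  apply/eqP; rewrite -all_count; apply/allP => x xX.
  have [xz xal xbe] := copy_common cp xX.
  have xo : x != o by apply: contraNneq oX => <-.
  by move: be_uv; case: Eo => -[? ?]; rewrite /= /loc !in_tri !inE; decide_eqs.
have [be_in|be_in] := boolP (be \in [:: u; v]).
  have [o Eo] : exists o, (be = u /\ o = v) \/ (be = v /\ o = u).
    by move: be_in; rewrite !inE => /orP [] /eqP ->; [exists v; left|exists u; right].
  have := star al (X ++ L) o uXL.
  move=> H; have {}H : size (X ++ L) - 1 <= count (fun x => predC (loc k u v) (tri z al x)) (X ++ L).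
    apply: H => x /(copy_leaf cp) [xz xal xbe]; move: al_uv; case: Eo => -[? ?];
      by rewrite /loc !in_tri !inE; decide_eqs.
  by lia.
have two g (Y : seq nat) : uniq Y -> g \notin [:: u; v] ->
    size Y - 2 <= count (fun x => predC (loc k u v) (tri z g x)) Y.
  move=> uY guv; apply: nloc; apply: (@count_le2 _ _ u v) => // x _; move: guv.
  by rewrite /loc !in_tri !inE; decide_eqs.
have := two al (X ++ L) uXL al_uv; have := two be X uX be_in.
by rewrite sXL sX; lia.
Qed.
End LocalCount.

(** * The potential of a local structure *)

Definition swap (u v x : nat) := if x == u then v else if x == v then u else x.

Lemma swapK u v : involutive (swap u v).
Proof. by move=> x; rewrite /swap; do !case: eqP => //; congruence. Qed.

Definition mirror (u v : nat) (e : {fset nat}) : {fset nat} :=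
  [fset swap u v x | x in e]%fset.

Lemma in_mirror u v e x : (x \in mirror u v e) = (swap u v x \in e).
Proof.
apply/imfsetP/idP => /= [[y ye ->]|xe]; first by rewrite swapK.
by exists (swap u v x); rewrite ?swapK.
Qed.

Lemma mirrorK u v : involutive (mirror u v).
Proof. by move=> e; apply/fsetP => x; rewrite !in_mirror swapK. Qed.

Lemma K_mirror u v e : K_aleph0_3 (mirror u v e) = K_aleph0_3 e.
Proof.
by rewrite /K_aleph0_3 card_imfset //; apply: inv_inj; apply: swapK.
Qed.

Lemma mirror_tri (k u v x : nat) : k != u -> k != v -> x != u -> x != v ->
  mirror u v (tri k u x) = tri k v x.
Proof.
move=> ku kv xu xv; apply/fsetP => y; rewrite in_mirror !in_tri /swap.
by case: (eqVneq y u) => [->|yu]; [|case: (eqVneq y v) => [->|yv]]; decide_eqs.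
Qed.

Section Potential.
Variables (k u v : nat).
Hypotheses (uk : u != k) (vk : v != k) (uv : u != v).

Lemma mem_mirror_l e : (u \in mirror u v e) = (v \in e).
Proof. by rewrite in_mirror /swap eqxx. Qed.

Lemma mem_mirror_r e : (v \in mirror u v e) = (u \in e).
Proof. by rewrite in_mirror /swap eqxx eq_sym (negPf uv). Qed.

Lemma loc_mirror e : loc k u v (mirror u v e) = loc k u v e.
Proof.
rewrite /loc mem_mirror_l mem_mirror_r in_mirror /swap.
by rewrite ![k == _]eq_sym (negPf uk) (negPf vk) addbC.
Qed.

(* An edge whose mirror image belongs to the other player can no longer
   contribute to a pair. *)
Definition potential (s1 s2 : seq {fset nat}) :=
  count (fun e => loc k u v e && (mirror u v e \notin s2)) s1.

Lemma potential_cons e s1 s2 : potential (e :: s1) s2 <= (potential s1 s2).+1.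
Proof. by rewrite /potential /=; case: (_ && _); rewrite ?add1n ?add0n. Qed.

Lemma potential_anti s1 s2 e : potential s1 (e :: s2) <= potential s1 s2.
Proof.
apply: sub_count => x /= /andP [-> ]; rewrite in_cons negb_or.
by case/andP.
Qed.

Lemma potential_block s1 s2 e : uniq s1 -> e \in s1 -> loc k u v e ->
  mirror u v e \notin s2 -> potential s1 (mirror u v e :: s2) < potential s1 s2.
Proof.
move=> us es le me; rewrite /potential -!size_filter.
set A := [seq x <- s1 | _]; set B := [seq x <- s1 | _].
apply: (@uniq_leq_size _ (e :: A) B).
  rewrite /= filter_uniq // andbT mem_filter in_cons eqxx /=.
  by rewrite !negb_and orbT.
move=> x; rewrite in_cons /A /B !mem_filter => /orP [/eqP ->|]; first by rewrite le me es.
by rewrite in_cons negb_or => /andP [/andP [-> /andP [_ ->]] ->].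
Qed.

(* The involution [mirror] pairs off the counted edges whose mirror image is
   also in [s1]; an odd potential therefore leaves one unpaired. *)
Lemma odd_potential s1 s2 : uniq s1 -> {in s1, forall e, e \notin s2} ->
  odd (potential s1 s2) ->
  exists e, [/\ e \in s1, loc k u v e, mirror u v e \notin s1 & mirror u v e \notin s2].
Proof.
move=> us ds od.
set H := [seq e <- s1 | loc k u v e && (mirror u v e \notin s2)].
have [|/hasPn H0] := boolP (has (fun e => mirror u v e \notin s1) H).
  case/hasP=> e; rewrite mem_filter => /andP [/andP [le me] es] m1.
  by exists e.
have uH : uniq H by apply: filter_uniq.
have clH e : e \in H -> mirror u v e \in H.
  move=> eH; have := H0 _ eH; rewrite negbK => ms.
  move: eH; rewrite !mem_filter ms loc_mirror mirrorK => /andP [/andP [-> _] es].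
  by rewrite ds.
have sz : count (fun e : {fset nat} => u \in e) H = count (fun e : {fset nat} => u \notin e) H.
  rewrite -!size_filter -(size_map (mirror u v)).
  apply: perm_size; apply: uniq_perm.
  - by rewrite map_inj_uniq ?filter_uniq //; apply: inv_inj; apply: mirrorK.
  - exact: filter_uniq.
  have xorH e : e \in H -> (u \in e) = (v \notin e).
    by rewrite mem_filter => /andP [/andP [/andP [_ ]]]; case: (u \in e); case: (v \in e).
  move=> e; apply/mapP/idP => [[e' ]|].
    rewrite mem_filter => /andP [ue eH] ->.
    by rewrite mem_filter mem_mirror_l clH // andbT; move: ue; rewrite xorH.
  rewrite mem_filter => /andP [ue eH]; exists (mirror u v e); last by rewrite mirrorK.
  rewrite mem_filter mem_mirror_l clH // andbT.
  by move: ue; rewrite xorH // negbK.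
move: od; rewrite /potential -size_filter -/H -(count_predC (fun e : {fset nat} => u \in e) H).
by rewrite sz addnn odd_double.
Qed.

(** One move raises the potential by at most one, so the bound can be broken only by reaching
    [(2 * t).+1]. This number is odd, so some local edge of P1 has a free mirror image, and P2
    restores the bound by claiming it. *)
Lemma potential_reply t s1 s2 e : uniq (e :: s1 ++ s2) ->
  all K_aleph0_3 (e :: s1 ++ s2) -> potential s1 s2 <= 2 * t ->
  potential (e :: s1) s2 <= 2 * t \/
  (loc k u v e /\ exists e', [/\ K_aleph0_3 e', e' \notin e :: s1 ++ s2, loc k u v e' &
     potential (e :: s1) (e' :: s2) <= 2 * t]).
Proof.
move=> us aK ps; case: (leqP (potential (e :: s1) s2) (2 * t)) => H; first by left.
right; have E : potential (e :: s1) s2 = (2 * t).+1.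
  by apply/eqP; rewrite eqn_leq H andbT; apply: leq_trans (potential_cons _ _ _) _.
have le : loc k u v e.
  by apply: contraLR H; rewrite /potential /= => /negPf ->; rewrite -leqNgt.
split=> //; move: us; rewrite -cat_cons cat_uniq => /and3P [u1 /hasPn dj _].
have dj' : {in e :: s1, forall x, x \notin s2}.
  by move=> x x1; apply/negP => /dj; rewrite x1.
have [|x [x1 lx m1 m2]] := odd_potential u1 dj'; first by rewrite E /= mul2n odd_double.
exists (mirror u v x); split.
- by rewrite K_mirror; move/allP: aK; apply; rewrite -cat_cons mem_cat x1.
- by rewrite (mem_cat _ (e :: s1)) negb_or m1.
- by rewrite loc_mirror.
- by rewrite -ltnS -E; apply: potential_block.
Qed.

(** Two mirror images both owned by P1 are both counted, since neither can belong to P2. *)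
Lemma potential_ge X s1 s2 : uniq X -> {in s1, forall e, e \notin s2} ->
  {in X, forall x, [/\ x != k, x != u & x != v]} ->
  {in X, forall x, tri k u x \in s1 /\ tri k v x \in s1} ->
  2 * size X <= potential s1 s2.
Proof.
move=> uX dj HX H.
pose T := [seq tri k u x | x <- X] ++ [seq tri k v x | x <- X].
have -> : 2 * size X = size T by rewrite size_cat !size_map addnn mul2n.
rewrite /potential -size_filter; apply: uniq_leq_size.
  rewrite cat_uniq !map_inj_in_uniq ?uX /= ?andbT.
  - apply/hasPn => e /mapP [x xX ->]; apply/mapP => -[y yX /fsetP /(_ u)].
    by have [? ? ?] := HX _ xX; rewrite !in_tri; decide_eqs.
  - by move=> x y /HX [? ? ?] _; apply: tri_inj.
  - by move=> x y /HX [? ? ?] _; apply: tri_inj.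
have mr x : x \in X -> mirror u v (tri k u x) = tri k v x.
  by move=> /HX [? ? ?]; apply: mirror_tri; rewrite // eq_sym.
move=> e; rewrite mem_cat mem_filter => /orP [] /mapP [x xX ->];
  have [h1 h2] := H _ xX; have [? ? ?] := HX _ xX.
- by rewrite mr // dj // h1 /loc !in_tri; decide_eqs.
- by rewrite -mr // mirrorK dj // mr // h2 /loc !in_tri; decide_eqs.
Qed.

(** A copy with centre [k] and pair [{u,v}] forces potential [2 * t.+1], and any other copy has more
    than [t] non-local edges. The bound [(2 * t).+1] leaves room for a move of P1 that is not yet
    answered. *)
Lemma no_copy_of_potential t s1 s2 : 3 <= t -> {in s1, forall e, e \notin s2} ->
  potential s1 s2 <= (2 * t).+1 -> count (predC (loc k u v)) s1 <= t -> ~ copy t s1.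
Proof.
move=> ht dj ps nl [z [al [be [X [L cp]]]]].
have [|ex] := boolP [&& z == k, al \in [:: u; v] & be \in [:: u; v]].
  case/and3P=> /eqP Ez ha hb; have [zal zbe albe] := copy_roles cp.
  have sX : size X = t.+1 by case: cp.
  have : 2 * size X <= potential s1 s2; last by lia.
  case: (cp) => _ _ _ H1 H2; move: ha hb; rewrite !inE.
  have H1' x : x \in X -> tri z al x \in s1 by move=> xX; apply: H1; rewrite mem_cat xX.
  move=> ha hb; apply: potential_ge => //; first exact: copy_common_uniq cp.
    move=> x /(copy_common cp) [xz xal xbe]; rewrite -Ez; split=> //.
    + by move: ha hb albe; decide_eqs.
    + by move: ha hb albe; decide_eqs.
  move=> x xX; have := H1' x xX; have := H2 x xX; rewrite Ez.
  case/orP: ha hb albe => /eqP -> /orP [] /eqP ->; rewrite ?eqxx // => _.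
suff le : count (predC (loc k u v)) (copy_edges z al be X L) <= count (predC (loc k u v)) s1.
  by have := leq_trans (count_nonloc_copy ht cp uk vk uv ex) (leq_trans le nl); rewrite ltnn.
apply: count_subset (copy_edges_uniq cp) _ => e ee _.
exact: copy_edges_sub cp _ ee.
Qed.

End Potential.

(** * Copies completed during perpetual threats *)

Definition star (c b : nat) (Y : seq nat) := [seq tri c b y | y <- Y].

Lemma mem_star c b Y x : x != c -> x != b -> (tri c b x \in star c b Y) = (x \in Y).
Proof.
move=> xc xb; apply/mapP/idP => [[y yY /tri_inj -> //]|xY]; by exists x.
Qed.

Lemma center_star c b Y e : e \in star c b Y -> (c \in e) && (b \in e).
Proof. by case/mapP=> y _ ->; rewrite !in_tri !eqxx orbT. Qed.

Lemma star_uniq c b Y : uniq Y -> {in Y, forall y, y != c /\ y != b} -> uniq (star c b Y).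
Proof.
move=> uY HY; rewrite map_inj_in_uniq // => x y /HY [? ?] _; exact: tri_inj.
Qed.

Lemma count_le3 (T : Type) (P Q R : pred T) s :
  all (fun x => [|| P x, Q x | R x]) s -> size s <= count P s + count Q s + count R s.
Proof.
elim: s => //= x s IH /andP [h /IH]; move: h.
by case: (P x); case: (Q x); case: (R x) => //= _; lia.
Qed.

(** * Copies in which [c] and [b] are the centre and a vertex of the pair *)

Section TightStar.
Variables (t z o ga : nat) (X Y J : seq nat) (F D : seq {fset nat}) (g : {fset nat}).
Hypotheses (uX : uniq X) (sX : size X = t.+1) (zo : z != o) (oga : o != ga).
Hypothesis nX : {in X, forall x, [/\ x != z, x != o & x != ga]}.
Hypotheses (sF : size F <= 1) (sJ : size J <= t.-1) (t0 : 0 < t).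
Hypothesis HA : {in X, forall x, [\/ x \in Y, x \in J, tri z o x \in F | tri z o x = g]}.
Hypothesis HB : {in X, forall x, [\/ tri z ga x \in F, tri z ga x = g | tri z ga x \in D]}.
Hypothesis HY : {in Y, forall y, [/\ y \notin J, tri z ga y \notin F & tri z ga y \notin D]}.

Let o_notin x : x \in X -> o \notin tri z ga x.
Proof. by move=> /nX [? ? ?]; rewrite in_tri; decide_eqs. Qed.

Let o_in x : o \in tri z o x.
Proof. by rewrite in_tri eqxx orbT. Qed.

(* The [t.+1] edges [tri z o x] must all be found among the at most [t.-1]
   edges of the star over [J], the edge of [F], and [g] (directly, or through
   a fresh [y] whose second edge is [g]): so every one of these is used. *)
Lemma tight_star :
  t <= count (fun x => tri z ga x \in D) X /\
  {in J, forall j, tri z ga j \in D}.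
Proof.
have injga x y : x \in X -> tri z ga x = tri z ga y -> x = y.
  by move=> /nX [? ? ?]; apply: tri_inj.
have injo x y : x \in X -> tri z o x = tri z o y -> x = y.
  by move=> /nX [? ? ?]; apply: tri_inj.
have Fu e e' : e \in F -> e' \in F -> e = e'.
  by case: F sF => [|f [|]] //= _; rewrite !inE => /eqP -> /eqP ->.
have Yg x : x \in X -> x \in Y -> tri z ga x = g.
  by move=> xX xY; have [h1 h2 h3] := HY xY; case: (HB xX) => //; rewrite ?(negPf h2) ?(negPf h3).
pose P3 x := (x \in Y) || (tri z o x == g).
have c1 : count (mem J) X <= size J.
  rewrite -size_filter; apply: uniq_leq_size; first exact: filter_uniq.
  by move=> x; rewrite mem_filter => /andP [].
have c2 : count (fun x => tri z o x \in F) X <= 1.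
  case: (boolP (has (fun x => tri z o x \in F) X)) => [/hasP [a aX aF]|]; last first.
    by rewrite has_count -leqNgt leqn0 => /eqP ->.
  by apply: (@count_le1 _ _ a) => // x xX xF; apply: injo => //; apply: Fu.
(* [g] serves only once: as [tri z ga x] it avoids [o], as [tri z o x] it contains [o], and in
   either form it determines [x]. *)
have P3u x y : x \in X -> y \in X -> P3 x -> P3 y -> x = y.
  move=> xX yX /orP [xY|/eqP xg] /orP [yY|/eqP yg].
  - by apply: injga => //; rewrite !Yg.
  - by have := o_notin xX; rewrite Yg // -yg o_in.
  - by have := o_notin yX; rewrite Yg // -xg o_in.
  - by apply: injo => //; rewrite xg yg.
have c3 : count P3 X <= 1.
  case: (boolP (has P3 X)) => [/hasP [a aX aF]|]; last first.
    by rewrite has_count -leqNgt leqn0 => /eqP ->.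
  by apply: (@count_le1 _ _ a) => // x xX xF; apply: P3u.
have tot : size X <= count (mem J) X + count (fun x => tri z o x \in F) X + count P3 X.
  apply: count_le3; apply/allP => x xX; rewrite /P3.
  by case: (HA xX) => [->|/= ->|->|->]; rewrite ?eqxx ?orbT.
have [n1 n2 n3] : [/\ size J <= count (mem J) X,
    0 < count (fun x => tri z o x \in F) X & 0 < count P3 X].
  move: sJ t0 c1 c2 c3 tot; rewrite sX; move: (size J) (count _ X) (count _ X) (count _ X).
  by move=> *; split; lia.
have [x2 x2X x2F] : exists2 x, x \in X & tri z o x \in F.
  by apply/hasP; rewrite has_count.
have [x3 x3X x3P] : exists2 x, x \in X & P3 x.
  by apply/hasP; rewrite has_count.
have JX : {subset J <= X}.
  have szJ : size J <= size [seq x <- X | x \in J] by rewrite size_filter.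
  move=> j jJ; have [|_ E] := uniq_min_size (filter_uniq (mem J) uX) _ szJ.
    by move=> x; rewrite mem_filter => /andP [].
  by move: jJ; rewrite -E mem_filter => /andP [].
(* The only edge of [F] is [tri z o x2], which contains [o]; so in the star at [ga] only [g] can lie
   outside [D]. *)
have gaF x : x \in X -> tri z ga x \notin F.
  move=> xX; apply/negP => xF; have := o_notin xX.
  by rewrite (Fu _ _ xF x2F) o_in.
split.
  suff : count (predC (fun x => tri z ga x \in D)) X <= 1.
    by have := count_predC (fun x => tri z ga x \in D) X; rewrite sX; lia.
  have ng x : x \in X -> tri z ga x \notin D -> tri z ga x = g.
    by move=> xX xD; case: (HB xX) => //; rewrite ?(negPf (gaF _ xX)) ?(negPf xD).
  case: (boolP (has (predC (fun x => tri z ga x \in D)) X)) => [/hasP [a aX aF]|]; last first.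
    by rewrite has_count -leqNgt leqn0 => /eqP ->.
  by apply: (@count_le1 _ _ a) => // x xX xF; apply: injga => //; rewrite (ng x xX xF) (ng a aX aF).
move=> j jJ; have jX := JX _ jJ; case: (HB jX) => //; first by rewrite (negPf (gaF _ jX)).
move=> jg; case/orP: x3P => [x3Y|/eqP x3g].
  have E : x3 = j by apply: injga; rewrite // Yg.
  by have [] := HY x3Y; rewrite E jJ.
by have := o_notin jX; rewrite jg -x3g o_in.
Qed.

End TightStar.

(* [B0] are the edges of P1 before the threats, [star c b Y] his forced answers
   at fresh vertices, and [g] a move made instead of an answer. *)
Definition perp_safe t (c b : nat) (B0 s2 : seq {fset nat}) := forall Y g,
  {in Y, forall y, [/\ y != c, y != b & {in B0, forall e : {fset nat}, y \notin e}]} ->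
  g \notin s2 -> ~ copy t (g :: star c b Y ++ B0).

(** * Edge counts for a copy covered by the star over [Y] and [J], [g], [F] and [D] *)

Section Endgame.
Variables (t z al be : nat) (X L : seq nat) (S : seq {fset nat}).
Hypotheses (ht : 3 <= t) (cp : copy_at t z al be X L S).
Variables (c b : nat) (Y J : seq nat) (F D : seq {fset nat}) (g : {fset nat}).
Hypotheses (cb : c != b) (sF : size F <= 1) (sJ : size J = t.-1).
Hypothesis cover : {in copy_edges z al be X L, forall e,
  [|| e \in star c b (Y ++ J), e \in g :: F | e \in D]}.
Hypothesis HY : {in Y, forall y, [/\ y != c, y != b, y \notin J &
  {in F ++ D, forall e : {fset nat}, y \notin e}]}.
Hypothesis HD : forall x, tri c b x \notin D.

(** The constant 2 stands for [g] and the single edge of [F]. *)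
Lemma endgame_count :
  3 * t <= count [in star c b (Y ++ J)] (copy_edges z al be X L) + 2
           + count [in D] (copy_edges z al be X L).
Proof.
rewrite -(size_copy_edges ht cp).
apply: leq_trans (count_le3 (P := [in star c b (Y ++ J)]) (Q := [in g :: F])
  (R := [in D]) _) _; first by apply/allP => e /cover.
rewrite leq_add2r leq_add2l.
rewrite -size_filter; apply: (@leq_trans (size (g :: F))); last by rewrite /= ltnS.
apply: uniq_leq_size; first by apply: filter_uniq; apply: copy_edges_uniq cp.
by move=> x; rewrite mem_filter => /andP [].
Qed.

(** Every edge of the copy contains [z]; if [z] is neither [c] nor [b], the only possible star edge
    is [tri c b z]. *)
Lemma endgame_center :
  1 < count [in star c b (Y ++ J)] (copy_edges z al be X L) -> z = c \/ z = b.
Proof.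
case: (eqVneq z c) => [|zc]; first by left.
case: (eqVneq z b) => [|zb]; first by right.
rewrite ltnNge => /negP []; apply: (@count_le1 _ _ (tri c b z)).
  exact: copy_edges_uniq cp.
move=> e ee /mapP [y _ Ey]; have := center_copy_edges ee.
by rewrite Ey in_tri (negPf zc) (negPf zb) => /eqP ->.
Qed.

(** This is [tight_star] with [z], [o] the vertices [c], [b] in some order and [ga] the vertex of
    the pair other than [o]. *)
Lemma endgame_tight o : (z = c /\ o = b) \/ (z = b /\ o = c) ->
  o = al \/ o = be -> exists ga, [/\ ga = al \/ ga = be,
    t <= count (fun x => tri z ga x \in D) X & {in J, forall j, tri z ga j \in D}].
Proof.
move=> zo ho; have [zal zbe albe] := copy_roles cp.
have zo' : z != o by case: zo => -[-> ->]; rewrite // eq_sym.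
have tE x : tri c b x = tri z o x by case: zo => -[-> ->] //; rewrite triCl.
have sE W : star c b W = star z o W by apply: eq_map => x; rewrite tE.
have inX x : x \in X -> tri z al x \in copy_edges z al be X L /\
    tri z be x \in copy_edges z al be X L.
  by move=> xX; rewrite !mem_cat; split; apply/orP; [left|right]; apply: map_f;
     rewrite // mem_cat xX.
have [ga [hga oga]] : exists ga, (ga = al /\ o = be \/ ga = be /\ o = al) /\ o != ga.
  by case: ho => ->; [exists be|exists al]; split; [right|rewrite //|left|rewrite // eq_sym].
have nX x : x \in X -> [/\ x != z, x != o & x != ga].
  by move=> /(copy_common cp) [? ? ?]; case: hga => -[-> ->].
have zga : z != ga by case: hga => -[-> _].
have inoX x : x \in X -> tri z o x \in copy_edges z al be X L /\
    tri z ga x \in copy_edges z al be X L.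
  by move=> /inX [? ?]; case: hga => -[-> ->].
suff [h1 h2] : t <= count (fun x => tri z ga x \in D) X /\ {in J, forall j, tri z ga j \in D}.
  by exists ga; split=> //; case: hga => -[-> _]; [left|right].
have oin x : o \in tri z o x by rewrite in_tri eqxx orbT.
have onin x : x \in X -> o \notin tri z ga x.
  by move=> /nX [? ? ?]; rewrite in_tri; decide_eqs.
apply: (@tight_star t z o ga X Y J F D g) => //.
- exact: copy_common_uniq cp.
- by case: cp.
- by rewrite sJ.
- by lia.
- move=> x xX; have [xz xo xga] := nX x xX; have [/cover + _] := inoX x xX.
  rewrite sE mem_star // mem_cat in_cons.
  rewrite -tE (negPf (HD x)) orbF.
  by case/orP=> [/orP [] h|/orP [/eqP h|h]]; constructor.
- move=> x xX; have [_ /cover] := inoX x xX; rewrite in_cons.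
  case/or3P=> [|/orP [/eqP h|h]|h]; try by constructor.
  rewrite sE => /center_star /andP [_]; by rewrite (negPf (onin x xX)).
- move=> y /HY [yc yb yJ yF]; split=> //.
  + by apply/negP => h; have := yF (tri z ga y); rewrite mem_cat h => /(_ isT); rewrite in_tri eqxx !orbT.
  + by apply/negP => h; have := yF (tri z ga y); rewrite mem_cat h orbT => /(_ isT); rewrite in_tri eqxx !orbT.
Qed.

End Endgame.

Lemma count_sub_in (T : eqType) (P Q : pred T) s :
  {in s, forall x, P x -> Q x} -> count P s <= count Q s.
Proof.
move=> H; have -> : count P s = count (predI P Q) s.
  by apply: eq_in_count => x xs /=; case E: (P x) => //; rewrite (H x xs E).
by apply: sub_count => x /= /andP [].
Qed.

(** Used with [r] the star over [J]: blocking has cost P1 [t.-1] of his at most [t] counted edges,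
    so one is left for [F]. *)
Lemma size_rest (T : eqType) (P : pred T) (s r : seq T) n :
  uniq s -> uniq r -> {in r, forall e, e \in s /\ P e} -> count P s <= n ->
  size [seq e <- s | P e && (e \notin r)] <= n - size r.
Proof.
move=> us ur rs cn; rewrite leq_subRL.
  rewrite -size_cat; apply: leq_trans cn; rewrite -size_filter.
  apply: uniq_leq_size.
    rewrite cat_uniq ur filter_uniq // andbT; apply/hasPn => e.
    by rewrite mem_filter => /andP [/andP [_ ->]].
  move=> e; rewrite mem_cat !mem_filter => /orP [/rs [-> ->] //|/andP [/andP [-> _] ->] //].
apply: leq_trans cn; rewrite -size_filter; apply: uniq_leq_size => // e /rs [es Pe].
by rewrite mem_filter Pe.
Qed.

(** * Two situations in which perpetual threats are safe for P2 *)

Section PerpSafe.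
Variables (t c b : nat) (J : seq nat) (B0 s2 : seq {fset nat}).
Hypotheses (ht : 3 <= t) (cb : c != b) (uJ : uniq J) (sJ : size J = t.-1).
Hypothesis JB : {in J, forall j, [/\ tri c b j \in B0, j != c & j != b]}.
Hypotheses (uB : uniq B0) (dB : {in B0, forall e, e \notin s2}).

Let uT : uniq (star c b J).
Proof. by apply: star_uniq => // j /JB []. Qed.

Lemma mem_JB e : e \in star c b J -> e \in B0.
Proof. by case/mapP => j /JB [? _ _] ->. Qed.

Lemma fresh_notin_J y : {in B0, forall e : {fset nat}, y \notin e} -> y \notin J.
Proof.
by move=> yB; apply/negP => /JB [/yB + _ _]; rewrite in_tri eqxx !orbT.
Qed.

(** The blocking edges avoid [k], so they are non-local and leave at most one other non-local edge.
    If the centre of a copy is among [k], [u], [v], either the potential or the number of non-local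
    edges is too small. Otherwise the copy has at most two local edges, while the tight case would
    need [t]. *)
Lemma perp_safe_local k u v : u != k -> v != k -> u != v ->
  c \notin [:: k; u; v] -> b \notin [:: k; u; v] -> k \notin J ->
  (exists2 e : {fset nat}, e \in B0 & k \in e) ->
  potential k u v B0 s2 <= 2 * t -> count (predC (loc k u v)) B0 <= t ->
  perp_safe t c b B0 s2.
Proof.
move=> uk vk uv cT bT kJ [e0 e0B ke0] pB nB Y g HY gs2 [z [al [be [X [L cp]]]]].
have [ck cu cv] : [/\ c != k, c != u & c != v] by move: cT; rewrite !inE !negb_or => /and3P.
have [bk bu bv] : [/\ b != k, b != u & b != v] by move: bT; rewrite !inE !negb_or => /and3P.
(* [k] lies in the old edge [e0], so it is not a fresh vertex and no answer to a threat contains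
   it. *)
have kY : k \notin Y by apply/negP => /HY [_ _ /(_ _ e0B)]; rewrite ke0.
have kstar e : e \in star c b (Y ++ J) -> k \notin e.
  case/mapP=> y; rewrite mem_cat => yYJ ->; rewrite in_tri.
  rewrite ![k == _]eq_sym (negPf ck) (negPf bk) /=; apply/eqP => E; move: yYJ.
  by rewrite E (negPf kY) (negPf kJ).
pose F := [seq e <- B0 | predC (loc k u v) e && (e \notin star c b J)].
pose D := [seq e <- B0 | loc k u v e].
have sF : size F <= 1.
  have -> : 1 = t - size (star c b J) by rewrite size_map sJ; clear -ht; lia.
  apply: size_rest => // e eT; split; first exact: mem_JB.
  rewrite /= /loc; suff /negPf -> : k \notin e by [].
  by apply: kstar; case/mapP: eT => j jJ ->; apply: map_f; rewrite mem_cat jJ orbT.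
have cover0 e : e \in g :: star c b Y ++ B0 ->
    [|| e \in star c b (Y ++ J), e \in g :: F | e \in D].
  rewrite in_cons mem_cat /star map_cat mem_cat -/(star c b Y) -/(star c b J).
  rewrite in_cons /F /D !mem_filter /=.
  by case: (e == g); case: (e \in star c b Y); case: (e \in star c b J);
     case: (e \in B0); case: (loc k u v e).
have cover : {in copy_edges z al be X L, forall e,
    [|| e \in star c b (Y ++ J), e \in g :: F | e \in D]}.
  by move=> e /(copy_edges_sub cp) /cover0.
have FDB e : e \in F ++ D -> e \in B0.
  by rewrite mem_cat !mem_filter => /orP [] /andP [].
have [zT|zT] := boolP (z \in [:: k; u; v]).
  have zc : z != c by apply: contraNneq cT => <-.
  have zb : z != b by apply: contraNneq bT => <-.
  have ex : ~~ [&& z == k, al \in [:: u; v] & be \in [:: u; v]].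
    apply/negP => /and3P [/eqP Ez ha hb].
    have [zal zbe albe] := copy_roles cp.
    have sX : size X = t.+1 by case: cp.
    (* Star edges over [Y] avoid [k], so only [g] is added to [B0]: the potential stays at most
       [(2 * t).+1], below [2 * t.+1]. *)
    have : 2 * size X <= potential k u v (g :: B0) s2; last first.
      apply/negP; rewrite -ltnNge sX.
      apply: (leq_ltn_trans (potential_cons _ _ _ _ _ _)).
      by rewrite mulnS !ltnS.
    case: (cp) => _ _ _ H1 H2; move: ha hb; rewrite !inE.
    have H1' x : x \in X -> tri z al x \in g :: star c b Y ++ B0.
      by move=> xX; apply: H1; rewrite mem_cat xX.
    have kin e : e \in g :: star c b Y ++ B0 -> k \in e -> e \in g :: B0.
      rewrite !in_cons mem_cat => /or3P [-> //|eY|->]; rewrite ?orbT // => ke.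
      by move: (kstar e); rewrite ke /star map_cat mem_cat -/(star c b Y) eY => /(_ isT).
    move=> ha hb; apply: potential_ge => //; first exact: copy_common_uniq cp.
    - by move=> e; rewrite in_cons => /orP [/eqP -> //|/dB].
    - move=> x /(copy_common cp) [xz xal xbe]; rewrite -Ez; split=> //.
      + by move: ha hb albe; decide_eqs.
      + by move: ha hb albe; decide_eqs.
    move=> x xX; have := kin _ (H1' x xX); have := kin _ (H2 x xX); rewrite Ez.
    rewrite !in_tri !eqxx => /(_ isT) + /(_ isT).
    by case/orP: ha hb albe => /eqP -> /orP [] /eqP ->; rewrite ?eqxx // => _.
  have := count_nonloc_copy ht cp uk vk uv ex.
  apply/negP; rewrite -leqNgt -size_filter.
  (* The only star edge through [z] is [tri c b z], so the copy has at most three non-local edges,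
     where more than [t] are required. *)
  apply: (@leq_trans (size (tri c b z :: g :: F))); last by rewrite /=; clear -sF ht; lia.
  apply: uniq_leq_size; first by apply: filter_uniq; apply: copy_edges_uniq cp.
  move=> e; rewrite mem_filter in_cons => /andP [ne ee].
  case/or3P: (cover e ee) => [/mapP [y _ Ey]|->|]; last by rewrite mem_filter (negPf ne).
    have := center_copy_edges ee; rewrite Ey in_tri (negPf zc) (negPf zb) /= => /eqP ->.
    by rewrite eqxx.
  by rewrite orbT.
have c2 : count (loc k u v) (copy_edges z al be X L) <= 2 by apply: count_loc_copy cp _ _ _ uk vk zT.
have cD : count [in D] (copy_edges z al be X L) <= 2.
  by apply: leq_trans c2; apply: sub_count => e /=; rewrite mem_filter => /andP [].
have HY' : {in Y, forall y, [/\ y != c, y != b, y \notin J &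
  {in F ++ D, forall e : {fset nat}, y \notin e}]}.
  by move=> y /HY [? ? yB]; split; rewrite // ?fresh_notin_J // => e /FDB /yB.
have HD x : tri c b x \notin D.
  rewrite mem_filter negb_and /loc !in_tri; apply/orP; left.
  by decide_eqs.
have cS : 2 < count [in star c b (Y ++ J)] (copy_edges z al be X L).
  have := endgame_count ht cp sF cover; move: cD.
  by move: (count _ _) (count _ _); clear -ht; lia.
have [o zo] : exists o, (z = c /\ o = b) \/ (z = b /\ o = c).
  by case: (endgame_center cp (ltnW cS)) => ->; [exists b; left|exists c; right].
have [oz oe] : o != z /\ forall e, e \in star c b (Y ++ J) -> o \in e.
  by case: zo => -[-> ->]; split; rewrite // 1?eq_sym // => e /center_star /andP [].
have ho : o = al \/ o = be.
  apply: (count_copy_edges_pair cp oz); apply: (leq_trans cS).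
  by apply: sub_count => e /oe.
have [ga [hga ct _]] := endgame_tight ht cp cb sF sJ cover HY' HD zo ho.
have : t <= 2; last by clear -ht; lia.
apply: (leq_trans ct); apply: leq_trans cD; rewrite count_cat !count_map.
case: hga => ->; last exact: leq_addl.
by apply: leq_trans (leq_addr _ _); rewrite count_cat leq_addr.
Qed.

(** Every copy misses an edge of [D], so at least [t.-1] of its edges are in the star and its centre
    is [c] or [b]. If the other of these is in the pair, the tight case contradicts the hypothesis
    on [J] or the absence of [b] from [D]. If not, the copy has at most two star edges, so it must
    take most of its edges from [D]. *)
Lemma perp_safe_wasted a (D : seq {fset nat}) : uniq D -> size D = 2 * t ->
  {subset D <= B0} -> count [predC D] B0 <= t ->
  {in D, forall e : {fset nat}, b \notin e} ->
  (forall z al be, z != al -> z != be -> al != be ->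
     exists2 e, e \in D & ~~ loc z al be e) ->
  a != c -> a \notin J ->
  count (fun e : {fset nat} => (c \in e) && (a \notin e)) D <= t.-1 ->
  (forall ga, ga != c -> exists2 j, j \in J & tri c ga j \notin D) ->
  perp_safe t c b B0 s2.
Proof.
move=> uD sD DB nB bD wasted ac aJ cDc DJ Y g HY gs2 [z [al [be [X [L cp]]]]].
pose F := [seq e <- B0 | predC [in D] e && (e \notin star c b J)].
have sF : size F <= 1.
  have -> : 1 = t - size (star c b J) by rewrite size_map sJ; clear -ht; lia.
  apply: size_rest => // e eT; split; first exact: mem_JB.
  by apply/negP => /bD; case/andP: (center_star eT) => _ ->.
have cover0 e : e \in g :: star c b Y ++ B0 ->
    [|| e \in star c b (Y ++ J), e \in g :: F | e \in D].
  rewrite in_cons mem_cat /star map_cat mem_cat -/(star c b Y) -/(star c b J).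
  rewrite in_cons /F !mem_filter /=.
  by case: (e == g); case: (e \in star c b Y); case: (e \in star c b J);
     case: (e \in B0); case: (e \in D).
have cover : {in copy_edges z al be X L, forall e,
    [|| e \in star c b (Y ++ J), e \in g :: F | e \in D]}.
  by move=> e /(copy_edges_sub cp) /cover0.
have FDB e : e \in F ++ D -> e \in B0.
  by rewrite mem_cat mem_filter => /orP [/andP []|/DB].
have HY' : {in Y, forall y, [/\ y != c, y != b, y \notin J &
  {in F ++ D, forall e : {fset nat}, y \notin e}]}.
  by move=> y /HY [? ? yB]; split; rewrite // ?fresh_notin_J // => e /FDB /yB.
have HD x : tri c b x \notin D.
  by apply/negP => /bD; rewrite in_tri eqxx orbT.
have [zal zbe albe] := copy_roles cp.
have uC := copy_edges_uniq cp.
have cD : count [in D] (copy_edges z al be X L) <= (2 * t).-1.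
  have [e eD ne] := wasted z al be zal zbe albe.
  rewrite -sD -(size_rem eD) -size_filter; apply: uniq_leq_size; first exact: filter_uniq.
  move=> x; rewrite mem_filter mem_rem_uniq // => /andP [xD xC].
  rewrite !inE xD andbT; apply: contraNneq ne => <-.
  exact: copy_edges_loc cp _ xC.
have cnt := endgame_count ht cp sF cover.
have cS : 1 < count [in star c b (Y ++ J)] (copy_edges z al be X L).
  by move: cD cnt; move: (count _ _) (count _ _); clear -ht; lia.
have [o zo] : exists o, (z = c /\ o = b) \/ (z = b /\ o = c).
  by case: (endgame_center cp cS) => ->; [exists b; left|exists c; right].
have [oz oe] : o != z /\ forall e, e \in star c b (Y ++ J) -> o \in e.
  by case: zo => -[-> ->]; split; rewrite // 1?eq_sym // => e /center_star /andP [].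
have [j0 j0J] : exists j, j \in J.
  by case: J sJ => [/= h|j J' _]; [move: h; clear -ht; lia|exists j; rewrite mem_head].
have [ho|ho] : (o = al \/ o = be) \/ (o != al /\ o != be).
  case: (eqVneq o al) => [h1|h1]; first by left; left.
  by case: (eqVneq o be) => [h2|h2]; [left; right|right].
  have [ga [hga _ gJ]] := endgame_tight ht cp cb sF sJ cover HY' HD zo ho.
  case: zo => -[Ez _].
    have gac : ga != c by rewrite -Ez eq_sym; case: hga => ->.
    by have [j jJ] := DJ ga gac; rewrite -Ez gJ.
  by have := bD _ (gJ _ j0J); rewrite Ez in_tri eqxx.
have co2 : count (fun e : {fset nat} => o \in e) (copy_edges z al be X L) <= 2.
  rewrite leqNgt; apply/negP => /(count_copy_edges_pair cp oz).
  by case: ho => /eqP ? /eqP ? [].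
have cS2 : count [in star c b (Y ++ J)] (copy_edges z al be X L) <= 2.
  by apply: leq_trans co2; apply: sub_count => e /oe.
case: zo => -[Ez Eo].
- pose P (e : {fset nat}) := (c \in e) && (a \notin e).
  have cP : count [pred e | (e \in D) && P e] (copy_edges z al be X L) <= t.-1.
    apply: leq_trans cDc; rewrite -!size_filter; apply: uniq_leq_size.
      exact: filter_uniq.
    by move=> e; rewrite !mem_filter => /andP [/andP [eD Pe] _]; rewrite -/(P e) Pe.
  pose Q (e : {fset nat}) := (e \in D) && (a \in e).
  (* At least [3t - 4] edges of the copy are in [D], and all contain [c]. At most [t.-1] of these
     avoid [a], so at least [2t - 3] contain [a], which puts [a] in the pair. *)
  have cQ : 2 < count Q (copy_edges z al be X L).
    have : count [in D] (copy_edges z al be X L) <=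
      count [pred e | (e \in D) && P e] (copy_edges z al be X L)
      + count Q (copy_edges z al be X L).
      rewrite -[X in _ <= X]count_predUI; apply: leq_trans (leq_addr _ _).
      apply: count_sub_in => e ee /= eD; rewrite /Q eD /P /=.
      by have := center_copy_edges ee; rewrite Ez => ->; case: (a \in e).
    move: cP cnt cS2; move: (count _ _) (count _ _) (count _ _) (count _ _).
    by clear -ht; lia.
  have az : a != z by rewrite Ez.
  have ha : a = al \/ a = be.
    apply: (count_copy_edges_pair cp az); apply: (leq_trans cQ).
    by apply: sub_count => e /andP [].
  have [e eC /andP [eD ae]] : exists2 e, e \in copy_edges z al be X L & Q e.
    by apply/hasP; rewrite has_count; apply: leq_trans cQ.
  have aY : a \notin Y by apply/negP => /HY [_ _ /(_ _ (DB _ eD))]; rewrite ae.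
  have ab : a != b by apply: contraTneq ae => ->; apply: bD.
  have [al' hal'] : exists al', (a = al /\ al' = be) \/ (a = be /\ al' = al).
    by case: ha => ->; [exists be; left|exists al; right].
  have : count [in star c b (Y ++ J)] (copy_edges z al be X L) <= 1; last first.
    by rewrite leqNgt cS.
  (* [b] is outside the pair, so a star edge of the copy is [tri c a b] or [tri c al' b]; the former
     is excluded because [a] is neither in [Y] nor in [J]. *)
  apply: (@count_le1 _ _ (tri z al' b)) => // e' e'C e'S.
  have := oe _ e'S; rewrite Eo.
  have na : tri z a b \notin star c b (Y ++ J).
    by rewrite Ez triCr mem_star // mem_cat negb_or aY.
  have [bz bal bbe] : [/\ b != z, b != al & b != be] by rewrite -Eo; case: ho.
  move: e'C; rewrite mem_cat => /orP [] /mapP [x xX Ee'];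
    move: e'S; rewrite Ee' in_tri (negPf bz) ?(negPf bal) ?(negPf bbe) /= => e'S /eqP Ex;
    move: e'S; rewrite -Ex; case: hal' => -[Ea ->] //; by rewrite -Ea (negPf na).
- have : count [in D] (copy_edges z al be X L) = 0.
    apply/eqP; rewrite -leqn0 leqNgt -has_count; apply/negP => /hasP [e eC /bD].
    by rewrite -Ez (center_copy_edges eC).
  move: cnt cS2; move: (count _ _) (count _ _); clear -ht; lia.
Qed.

End PerpSafe.

(** * Phases of the game *)

Lemma uniq_replace4 (T : eqType) (c a b y y' : T) W : uniq (c :: a :: b :: y :: W) ->
  y' \notin c :: a :: b :: W -> uniq (c :: a :: b :: y' :: W).
Proof.
rewrite /= !inE !negb_or ![y' == _]eq_sym.
by do ![case: (_ == _) => //=]; do ![case: (_ \in _) => //=].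
Qed.

(* P1 is to move and must answer the threat [tri c b y0]; [Y] are the vertices
   of the earlier threats, and [B0], [s20] the position when the first was made. *)
Definition perpetual t (s1 s2 : seq {fset nat}) :=
  exists (c a b : nat) (X0 L0 : seq nat) (B0 s20 : seq {fset nat}) (Y : seq nat) (y0 : nat),
  [/\ uniq (c :: a :: b :: (y0 :: X0) ++ L0), size X0 = t & size L0 = t - 2] /\
  [/\ {in (y0 :: X0) ++ L0, forall x, tri c a x \in s2},
      {in X0, forall x, tri c b x \in s2} & tri c b y0 \notin s2] /\
  [/\ s1 = star c b Y ++ B0,
      {in y0 :: Y, forall y, [/\ y != c, y != b & {in B0, forall e : {fset nat}, y \notin e}]},
      y0 \notin Y, {subset s20 <= s2} & perp_safe t c b B0 s20].

Lemma perpetual_step t s1 s2 e : 0 < t -> perpetual t s1 s2 -> uniq (e :: s1 ++ s2) ->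
  ~ copy t (e :: s1) /\
  exists e', [/\ K_aleph0_3 e', e' \notin e :: s1 ++ s2 &
    perpetual t (e :: s1) (e' :: s2) \/ copy t (e' :: s2)].
Proof.
move=> t0 [c [a [b [X0 [L0 [B0 [s20 [Y [y0]]]]]]]]].
case=> [[uV sX0 sL0] [[Ha Hb nb] [E1 HY y0Y s20s ps]]] us.
have es2 : e \notin s2.
  by move: us; rewrite /= mem_cat negb_or => /andP [/andP [_ ->]].
have HY' : {in Y, forall y, [/\ y != c, y != b & {in B0, forall e : {fset nat}, y \notin e}]}.
  by move=> y yY; apply: HY; rewrite in_cons yY orbT.
have [y0c y0b y0B] := HY y0 (mem_head _ _).
have [ca cb] : c != a /\ c != b.
  by move: uV; rewrite /= !inE !negb_or => /andP [/andP [-> /andP [-> _]] _].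
(* Whether or not [e] answers the threat, it can play the part of [g] in [perp_safe]. *)
split; first by rewrite E1; apply: ps => //; apply: contra es2; apply: s20s.
(* If P1 answers, [y0] joins [Y] and the fresh vertex [N] carries the next threat; if not,
   [tri c b y0] completes a copy with common neighbours [y0 :: X0]. *)
have [Ee|Ee] := eqVneq e (tri c b y0).
  have [N HN] := edges_bounded (e :: s1 ++ s2).
  have ins1 x : x \in s1 -> x \in e :: s1 ++ s2 by rewrite in_cons mem_cat => ->; rewrite orbT.
  have ins2 x : x \in s2 -> x \in e :: s1 ++ s2 by rewrite in_cons mem_cat => ->; rewrite !orbT.
  have HV x : x \in (y0 :: X0) ++ L0 -> x < N.
    by move=> /Ha /ins2 /HN; apply; rewrite in_tri eqxx !orbT.
  have cN : c < N by apply: (HN e); rewrite ?mem_head // Ee in_tri eqxx.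
  have bN : b < N by apply: (HN e); rewrite ?mem_head // Ee in_tri eqxx orbT.
  have aN : a < N.
    by apply: (HN (tri c a y0)); [apply: ins2; apply: Ha; rewrite mem_head|rewrite in_tri eqxx orbT].
  have BN e' : e' \in B0 -> N \notin e'.
    move=> e'B; apply/negP => /(HN e' _); rewrite ltnn => H; apply: notF; apply: H.
    by apply: ins1; rewrite E1 mem_cat e'B orbT.
  have Nc : N != c by rewrite gtn_eqF.
  have Nb : N != b by rewrite gtn_eqF.
  have Na : N != a by rewrite gtn_eqF.
  have YN y : y \in Y -> y < N.
    move=> yY; apply: (HN (tri c b y)); last by rewrite in_tri eqxx !orbT.
    by apply: ins1; rewrite E1 mem_cat map_f.
  have fresh e' : N \in e' -> e' \notin e :: s1 ++ s2.
    by move=> Ne; apply/negP => /HN /(_ N Ne); rewrite ltnn.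
  exists (tri c a N); split.
  - by apply: card_tri; rewrite // eq_sym.
  - by apply: fresh; rewrite in_tri eqxx !orbT.
  left; exists c, a, b, X0, L0, B0, s20, (y0 :: Y), N; split; last split; split=> //.
  - have NV : N \notin (y0 :: X0) ++ L0 by apply/negP => /HV; rewrite ltnn.
    apply: uniq_replace4 uV _; rewrite !in_cons !negb_or Nc Na Nb /=.
    by move: NV; rewrite cat_cons in_cons negb_or => /andP [].
  - move=> x; rewrite /= !in_cons => /orP [/eqP -> |xX]; first by rewrite eqxx.
    by rewrite Ha ?orbT // in_cons xX orbT.
  - by move=> x /Hb; rewrite in_cons => ->; rewrite orbT.
  - rewrite in_cons negb_or; apply/andP; split.
      apply/negP => /eqP /fsetP /(_ b); rewrite !in_tri eqxx orbT.
      have ab : a != b by move: uV; rewrite /= !inE !negb_or => /and3P [_ /andP [-> _] _].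
      by rewrite ![b == _]eq_sym (negPf cb) (negPf ab) (negPf Nb).
    apply: contra (fresh (tri c b N) _) => [/ins2 //|]; by rewrite in_tri eqxx !orbT.
  - by rewrite E1 Ee.
  - move=> y; rewrite in_cons => /orP [/eqP ->|]; last exact: HY.
    by split=> // e' /BN.
  - rewrite in_cons negb_or; apply/andP; split; last by apply/negP => /YN; rewrite ltnn.
    by rewrite gtn_eqF // HV // mem_head.
  - by move=> x /s20s; rewrite in_cons => ->; rewrite orbT.
exists (tri c b y0); split.
- by apply: card_tri; rewrite // eq_sym.
- rewrite in_cons mem_cat !negb_or eq_sym Ee nb andbT /= E1 mem_cat mem_star // negb_or y0Y /=.
  by apply/negP => /y0B; rewrite in_tri eqxx !orbT.
right; exists c, a, b, (y0 :: X0), L0; split=> //; first by rewrite /= sX0.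
- by move=> x /Ha xs; rewrite in_cons xs orbT.
- move=> x; rewrite in_cons => /orP [/eqP ->|/Hb xs]; first by rewrite mem_head.
  by rewrite in_cons xs orbT.
Qed.

(* [Loc] are the edges whose claiming by P1 does not count in the race, and
   [Bal] is the condition that P2 maintains against them. *)
Definition race_rules t c b (xs : seq nat) (Loc : pred {fset nat})
    (Bal : seq {fset nat} -> seq {fset nat} -> Prop) :=
  [/\ forall s1 s2 e, Bal s1 s2 -> Bal s1 (e :: s2),
      forall s1 s2 e, uniq (e :: s1 ++ s2) -> all K_aleph0_3 (e :: s1 ++ s2) -> Bal s1 s2 ->
        Bal (e :: s1) s2 \/
        (Loc e /\ exists e', [/\ K_aleph0_3 e', e' \notin e :: s1 ++ s2, Loc e' &
           Bal (e :: s1) (e' :: s2)]),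
      forall s1 s2 e, uniq (e :: s1 ++ s2) -> Bal s1 s2 ->
        count (predC Loc) (e :: s1) <= t -> ~ copy t (e :: s1) &
      forall s1 s2 J, uniq (s1 ++ s2) -> Bal s1 s2 ->
        count (predC Loc) s1 <= t -> uniq J -> size J = t.-1 -> {subset J <= xs} ->
        {in J, forall j, tri c b j \in s1} -> perp_safe t c b s1 s2].

(** P1 is to move. The strict inequality is P2's lead: his second edges [tri c b x] outnumber the
    non-local edges of P1. *)
Definition racing t s1 s2 := exists c a b xs Loc Bal,
  [/\ uniq (c :: a :: b :: xs), size xs = (2 * t).-1,
      {in xs, forall x, tri c a x \in s2} & {in xs, forall x, ~~ Loc (tri c b x)}] /\
  [/\ race_rules t c b xs Loc Bal, count (fun x => tri c b x \in s2) xs <= t,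
      count (predC Loc) s1 < count (fun x => tri c b x \in s2) xs & Bal s1 s2].

Lemma racing_step t s1 s2 e : 3 <= t -> racing t s1 s2 -> uniq (e :: s1 ++ s2) ->
  all K_aleph0_3 (e :: s1 ++ s2) ->
  ~ copy t (e :: s1) /\
  exists e', [/\ K_aleph0_3 e', e' \notin e :: s1 ++ s2 &
    [\/ racing t (e :: s1) (e' :: s2), perpetual t (e :: s1) (e' :: s2) | copy t (e' :: s2)]].
Proof.
move=> ht [c [a [b [xs [Loc [Bal]]]]]] [[uV sxs Ha nL] [[R0 R1 R2 R3] gt ng bal]] us aK.
have ne : count (predC Loc) (e :: s1) <= count (fun x => tri c b x \in s2) xs.
  by apply: leq_trans ng; rewrite /= -add1n leq_add2r leq_b1.
split; first by apply: (R2 _ s2) => //; apply: leq_trans gt.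
have uxs : uniq xs by move: uV => /= /and4P [].
have [ca [cb ab]] : c != a /\ c != b /\ a != b.
  by move: uV; rewrite /= !inE !negb_or => /and4P [/and3P [-> -> _] /andP [-> _] _ _].
have nV x : x \in xs -> [/\ x != c, x != a & x != b].
  move=> xx; move: uV; rewrite /= !inE !negb_or => /and4P [/and3P [_ _ h1] /andP [_ h2] h3 _].
  by split; [apply: contraNneq h1|apply: contraNneq h2|apply: contraNneq h3] => <-.
have us12 : {in e :: s1, forall x, x \notin s2}.
  move: us; rewrite -cat_cons cat_uniq => /and3P [_ /hasPn dj _] x x1.
  by apply/negP => /dj; rewrite x1.
have u1 : uniq (e :: s1) by move: us; rewrite -cat_cons cat_uniq => /and3P [].
case: (R1 _ _ _ us aK bal) => [bal'|[Le [e' [Ke' ne' Le' bal']]]]; last first.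
  exists e'; split=> //; apply: Or31; exists c, a, b, xs, Loc, Bal.
  have E : count (fun x => tri c b x \in e' :: s2) xs = count (fun x => tri c b x \in s2) xs.
    apply: eq_in_count => x /nL nx; rewrite in_cons.
    by case: eqP => // E; move: nx; rewrite E Le'.
  split; split=> //; first by move=> x /Ha xs2; rewrite in_cons xs2 orbT.
    by rewrite E.
  by rewrite E /= Le.
have [/hasP [x xx /andP [x1 x2]]|/hasPn no] :=
    boolP (has (fun x => (tri c b x \notin e :: s1) && (tri c b x \notin s2)) xs).
  have [xc xa xb] := nV _ xx.
  have E : count (fun y => tri c b y \in tri c b x :: s2) xs =
      (count (fun y => tri c b y \in s2) xs).+1.
    rewrite -add1n -(_ : count (pred1 x) xs = 1); last by rewrite count_uniq_mem // xx.
    rewrite -[RHS]count_predUI (_ : count (predI _ _) xs = 0); last first.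
      by apply/eqP; rewrite -leqn0 leqNgt -has_count; apply/negP => /hasP [y _ /= /andP [/eqP ->]]; apply/negP.
    rewrite addn0; apply: eq_in_count => y yx /=; rewrite in_cons; congr (_ || _).
    apply/eqP/eqP => [/tri_inj|-> //]; have [yc _ yb] := nV _ yx; exact.
  exists (tri c b x); split.
  - by apply: card_tri; rewrite // eq_sym.
  - by rewrite (mem_cat _ (e :: s1)) negb_or x1.
  (* If P2 already had [t] second edges, this is the last one needed, and the other [t - 2] of the
     [2t - 1] vertices become the leaves at [a]. *)
  have [gt'|gt'] := ltnP (count (fun x => tri c b x \in s2) xs) t.
    apply: Or31; exists c, a, b, xs, Loc, Bal; split; split=> //.
    - by move=> y /Ha ys2; rewrite in_cons ys2 orbT.
    - by rewrite E.
    - by rewrite E ltnS.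
    - exact: R0.
  apply: Or33; pose P y := tri c b y \in tri c b x :: s2.
  exists c, a, b, (filter P xs), (filter (predC P) xs).
  have pm : perm_eq (filter P xs ++ filter (predC P) xs) xs by apply/permPl/perm_filterC.
  have sP : size (filter P xs) = t.+1.
    by rewrite size_filter E; congr S; apply/eqP; rewrite eqn_leq gt gt'.
  split=> //.
  - move: uV; rewrite !cons_uniq !in_cons !(perm_mem pm) (perm_uniq pm).
    by [].
  - have := perm_size pm; rewrite size_cat sP sxs; move: (size _); clear -ht; lia.
  - by move=> y; rewrite (perm_mem pm) => /Ha ys; rewrite in_cons ys orbT.
  - by move=> y; rewrite mem_filter => /andP [].
pose P y := tri c b y \in s2.
have pm : perm_eq (filter P xs ++ filter (predC P) xs) xs by apply/permPl/perm_filterC.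
have J1 : {in filter (predC P) xs, forall j, tri c b j \in e :: s1}.
  by move=> j; rewrite mem_filter => /andP [nj /no]; rewrite negb_and !negbK -/(P j) (negbTE nj) orbF.
have sJ : size (filter (predC P) xs) <= count (predC Loc) (e :: s1).
  rewrite -(size_map (tri c b)) -[X in _ <= X]size_filter; apply: uniq_leq_size.
    rewrite map_inj_in_uniq ?filter_uniq // => x y; rewrite mem_filter => /andP [_ /nV [? ? ?]] _.
    exact: tri_inj.
  move=> x /mapP [j jJ ->]; rewrite mem_filter J1 // andbT /= nL //.
  by move: jJ; rewrite mem_filter => /andP [].
(* No leaf is free. P2 holds at most [t], P1 has blocked at most as many as P2 holds, and together
   they make [2t - 1]. *)
have [sP sJ'] : size (filter P xs) = t /\ size (filter (predC P) xs) = t.-1.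
  have := perm_size pm; rewrite size_cat sxs; move: sJ ne gt.
  rewrite -(size_filter P); move: (count _ _) (size _) (size _); clear -ht.
  by move=> *; split; lia.
have us' : uniq ((e :: s1) ++ s2) by [].
have ps : perp_safe t c b (e :: s1) s2.
  apply: (R3 _ _ (filter (predC P) xs)) => //; first by apply: leq_trans gt.
    exact: filter_uniq.
  by move=> x; rewrite mem_filter => /andP [].
have [N HN] := edges_bounded (e :: s1 ++ s2).
have ins1 x : x \in e :: s1 -> x \in e :: s1 ++ s2 by rewrite (mem_cat _ (e :: s1)) => ->.
have ins2 x : x \in s2 -> x \in e :: s1 ++ s2 by rewrite (mem_cat _ (e :: s1)) => ->; rewrite orbT.
have fresh e' : N \in e' -> e' \notin e :: s1 ++ s2.
  by move=> Ne; apply/negP => /HN /(_ N Ne); rewrite ltnn.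
have xN x : x \in xs -> x < N.
  by move=> /Ha /ins2 /HN; apply; rewrite in_tri eqxx !orbT.
have [x0 x0P] : exists x, x \in filter P xs.
  by case: (filter P xs) sP => [|x r _]; [move=> h; move: ht; rewrite -h|exists x; rewrite mem_head].
have x0x : tri c a x0 \in s2 by apply: Ha; move: x0P; rewrite mem_filter => /andP [].
have x0b : tri c b x0 \in s2 by move: x0P; rewrite mem_filter => /andP [].
have cN : c < N by apply: (HN _ (ins2 _ x0x)); rewrite in_tri eqxx.
have aN : a < N by apply: (HN _ (ins2 _ x0x)); rewrite in_tri eqxx orbT.
have bN : b < N by apply: (HN _ (ins2 _ x0b)); rewrite in_tri eqxx orbT.
have Nc : N != c by rewrite gtn_eqF.
have Nb : N != b by rewrite gtn_eqF.
have Na : N != a by rewrite gtn_eqF.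
exists (tri c a N); split.
- by apply: card_tri; rewrite // eq_sym.
- by apply: fresh; rewrite in_tri eqxx !orbT.
(* P2 still owns [tri c a x] over a blocked leaf [x], so blocked leaves serve as the leaves at
   [a]. *)
apply: Or32; exists c, a, b, (filter P xs), (take (t - 2) (filter (predC P) xs)), (e :: s1), s2, [::], N.
have sub : {subset filter P xs ++ take (t - 2) (filter (predC P) xs) <= xs}.
  move=> x; rewrite -(perm_mem pm) !mem_cat => /orP [->//|/mem_take ->]; by rewrite orbT.
split; last split; split=> //.
- have uf : uniq (filter P xs ++ take (t - 2) (filter (predC P) xs)).
    have : uniq (filter P xs ++ filter (predC P) xs) by rewrite (perm_uniq pm).
    rewrite -{1}(cat_take_drop (t - 2) (filter (predC P) xs)) catA cat_uniq.
    by case/andP.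
  rewrite /= uf; move: uV; rewrite /= !inE !negb_or ca cb ab /= => /and4P [h1 h2 h3 _].
  have subN x : x \notin xs -> x \notin filter P xs ++ take (t - 2) (filter (predC P) xs).
    exact: contra (@sub x).
  rewrite ![_ == N]eq_sym Nc Na Nb /= (subN c) // (subN a) // (subN b) // subN //.
  by apply/negP => /xN; rewrite ltnn.
- by rewrite size_take sJ'; clear -ht; case: ifP; lia.
- move=> x; rewrite cat_cons in_cons => /orP [/eqP ->|/sub /Ha h]; first by rewrite mem_head.
  by rewrite in_cons h orbT.
- by move=> x; rewrite mem_filter => /andP [h _]; rewrite in_cons; apply/orP; right.
- rewrite in_cons negb_or; apply/andP; split.
    apply/negP => /eqP /fsetP /(_ b); rewrite !in_tri eqxx orbT.
    by rewrite ![b == _]eq_sym (negPf cb) (negPf ab) (negPf Nb).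
  apply: contra (fresh (tri c b N) _) => [/ins2 //|]; by rewrite in_tri eqxx !orbT.
- move=> y; rewrite inE => /eqP ->; split=> // e' /ins1 e'1; apply/negP => /(HN _ e'1).
  by rewrite ltnn.
- by move=> x xs2; rewrite in_cons xs2 orbT.
Qed.

(** * The rules of the race in the local and in the wasted case *)

Lemma uniq_disjoint (T : eqType) (s1 s2 : seq T) :
  uniq (s1 ++ s2) -> {in s1, forall x, x \notin s2}.
Proof.
by rewrite cat_uniq => /and3P [_ /hasPn dj _] x x1; apply/negP => /dj; rewrite x1.
Qed.

(** Keeping [e0] among the edges of P1 ensures that [k] is an old vertex and never carries a
    threat. *)
Lemma race_rules_local t k u v c b xs (e0 : {fset nat}) : 3 <= t ->
  u != k -> v != k -> u != v -> c \notin [:: k; u; v] -> b \notin [:: k; u; v] ->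
  c != b -> c \notin xs -> b \notin xs -> k \notin xs -> k \in e0 ->
  race_rules t c b xs (loc k u v)
    (fun s1 s2 => potential k u v s1 s2 <= 2 * t /\ e0 \in s1).
Proof.
move=> ht uk vk uv cT bT cb cxs bxs kxs ke0; split.
- by move=> s1 s2 e [ps e01]; split=> //; apply: leq_trans (potential_anti _ _ _ _ _ _) ps.
- move=> s1 s2 e us aK [ps e01].
  have e01' : e0 \in e :: s1 by rewrite in_cons e01 orbT.
  case: (potential_reply uk vk uv us aK ps) => [|[le [e' [h1 h2 h3 h4]]]]; first by left.
  by right; split=> //; exists e'.
- move=> s1 s2 e us [ps e01] nl; apply: (no_copy_of_potential uk vk uv ht _ _ nl (s2 := s2)).
    by apply: uniq_disjoint.
  by apply: (leq_trans (potential_cons _ _ _ _ _ _)).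
move=> s1 s2 J us [ps e01] nl uJ sJ Jxs J1.
apply: (@perp_safe_local t c b J s1 s2 ht cb uJ sJ _ _ _ k u v) => //.
- move=> j jJ; split; first exact: J1.
  + by apply: contraNneq cxs => <-; apply: Jxs.
  + by apply: contraNneq bxs => <-; apply: Jxs.
- by move: us; rewrite cat_uniq => /and3P [].
- exact: uniq_disjoint.
- by apply: contra kxs; apply: Jxs.
- by exists e0.
Qed.

(** P1 has at most [3t] edges, just the size of a copy, and at least one of them is wasted. *)
Lemma no_copy_wasted t (D s : seq {fset nat}) : 3 <= t -> uniq s -> size D = 2 * t ->
  {subset D <= s} -> count [predC D] s <= t ->
  (forall z al be, z != al -> z != be -> al != be ->
     exists2 e, e \in D & ~~ loc z al be e) -> ~ copy t s.
Proof.
move=> ht us sD Ds nD wasted [z [al [be [X [L cp]]]]].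
have [zal zbe albe] := copy_roles cp.
have [e eD ne] := wasted z al be zal zbe albe.
have le : 3 * t <= size (rem e s).
  rewrite -(size_copy_edges ht cp); apply: uniq_leq_size; first exact: copy_edges_uniq cp.
  move=> x xC; rewrite mem_rem_uniq // !inE (copy_edges_sub cp xC) andbT.
  by apply: contraNneq ne => <-; apply: copy_edges_loc cp _ xC.
have cD : count [in D] s <= 2 * t.
  rewrite -sD -size_filter; apply: uniq_leq_size; first exact: filter_uniq.
  by move=> x; rewrite mem_filter => /andP [].
have cE : count [in D] s + count [predC D] s = size s := count_predC [in D] s.
have s0 : 0 < size s by move: (Ds _ eD); case: (s).
move: le cD nD s0 cE; rewrite size_rem; last exact: Ds.
move: (size s) (count _ _) (count _ _); clear -ht; lia.
Qed.

(* [x0] lies in every set [J] of [t.-1] leaves for which [star c ga J] exhausts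
   the edges of [D] through [c] avoiding [a]. *)
Lemma exists_key_leaf t c a (xs : seq nat) (D : seq {fset nat}) : 3 <= t ->
  0 < size xs -> uniq D -> all K_aleph0_3 D ->
  c \notin xs -> a \notin xs -> a != c ->
  count (fun e : {fset nat} => (c \in e) && (a \notin e)) D <= t.-1 ->
  exists2 x0, x0 \in xs & forall ga J, ga != c -> ga != a -> uniq J -> size J = t.-1 ->
    {subset J <= xs} -> {in J, forall j, tri c ga j \in D} -> x0 \in J.
Proof.
move=> ht sx uD KD cxs axs ac cD.
pose good ga J := [/\ ga != c /\ ga != a, uniq J /\ size J = t.-1, {subset J <= xs} &
  {in J, forall j, tri c ga j \in D}].
pose Dc := [seq e : {fset nat} <- D | (c \in e) && (a \notin e)].
have inDc ga J j : good ga J -> j \in J -> tri c ga j \in Dc.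
  case=> [[gc gaa] _ Jxs JD] jJ; rewrite mem_filter JD // andbT !in_tri eqxx /=.
  rewrite !negb_or ac eq_sym gaa /=; apply: contraNneq axs => ->; exact: Jxs.
have nJ ga J j : good ga J -> j \in J -> j != c /\ j != ga.
  case=> [_ _ Jxs JD] jJ; split; first by apply: contraNneq cxs => <-; apply: Jxs.
  apply/eqP => E; move/allP: KD => /(_ _ (JD _ jJ)); rewrite /K_aleph0_3 E.
  have -> : tri c ga ga = [fset c; ga]%fset by apply/fsetP => y; rewrite in_tri !inE orbb.
  by rewrite cardfs2; case: (_ != _).
(* [Dc] has at most [t.-1] edges, and the star over a good [J] already supplies that many. *)
have DcE ga J : good ga J -> {subset Dc <= star c ga J}.
  move=> gJ; have [_ [uJ sJ] Jxs JD] := gJ.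
  have uS : uniq (star c ga J) by apply: star_uniq => // j /(nJ _ _ _ gJ).
  have sS : {subset star c ga J <= Dc} by move=> x /mapP [j jJ ->]; apply: inDc gJ jJ.
  have [|_ E] := uniq_min_size uS sS; first by rewrite size_filter size_map sJ.
  by move=> x; rewrite E.
case: (classic (exists ga J, good ga J)) => [[ga0 [J0 g0]]|no]; last first.
  have [x xx] : exists x, x \in xs by case: (xs) sx => // x r _; exists x; rewrite mem_head.
  exists x => //.
  by move=> ga J h1 h2 h3 h4 h5 h6; case: no; exists ga, J.
have [[g0c g0a] [uJ0 sJ0] J0xs J0D] := g0.
have [x0 [x1 [x0J x1J x01]]] : exists x0 x1, [/\ x0 \in J0, x1 \in J0 & x0 != x1].
  case: J0 uJ0 sJ0 {g0 J0xs J0D} => [|x0 [|x1 J0]] /=; [move=> _; clear -ht; lia..|].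
  rewrite inE negb_or => /andP [/andP [x01 _] _] _; exists x0, x1.
  by rewrite !inE !eqxx orbT.
exists x0; first exact: J0xs.
move=> ga J gc gaa uJ sJ Jxs JD.
have gJ : good ga J by [].
(* A second vertex [ga] would lie on every edge of the star at [ga0], hence equal each of the
   several leaves in [J0]. *)
have step j : j \in J0 -> ga != ga0 -> j = ga.
  move=> jJ0 neq; have /mapP [j' j'J E] := DcE _ _ gJ _ (inDc _ _ _ g0 jJ0).
  have : ga \in tri c ga0 j by rewrite E in_tri eqxx orbT.
  by rewrite in_tri (negPf gc) (negPf neq) => /eqP.
have [Eg|neq] := eqVneq ga ga0.
  have /mapP [j' j'J E] := DcE _ _ gJ _ (inDc _ _ _ g0 x0J).
  have [x0c x0g] := nJ _ _ _ g0 x0J.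
  by move: E; rewrite Eg => /tri_inj -> //.
by move: x01; rewrite (step x0) // (step x1) // eqxx.
Qed.

(** With [Loc] equal to [D], every later move of P1 counts and no local reply is needed. P2 holds
    the edge over the key leaf [x0], so a set [J] blocked by P1 cannot contain it, and [star c ga J]
    never lies inside [D]. *)
Lemma race_rules_wasted t c a b xs x0 (D : seq {fset nat}) : 3 <= t ->
  uniq (c :: a :: b :: xs) -> uniq D -> size D = 2 * t ->
  {in D, forall e : {fset nat}, b \notin e} ->
  (forall z al be, z != al -> z != be -> al != be ->
     exists2 e, e \in D & ~~ loc z al be e) ->
  count (fun e : {fset nat} => (c \in e) && (a \notin e)) D <= t.-1 ->
  {in xs, forall x, tri c a x \notin D} ->
  (forall ga J, ga != c -> ga != a -> uniq J -> size J = t.-1 ->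
    {subset J <= xs} -> {in J, forall j, tri c ga j \in D} -> x0 \in J) ->
  race_rules t c b xs [in D] (fun s1 s2 => {subset D <= s1} /\ tri c b x0 \in s2).
Proof.
move=> ht uV uD sD bD wasted cD nD key.
have [ca [cb ab]] : c != a /\ c != b /\ a != b.
  by move: uV; rewrite /= !inE !negb_or => /and4P [/and3P [-> -> _] /andP [-> _] _ _].
have nV x : x \in xs -> [/\ x != c, x != a & x != b].
  move=> xx; move: uV; rewrite /= !inE !negb_or => /and4P [/and3P [_ _ h1] /andP [_ h2] h3 _].
  by split; [apply: contraNneq h1|apply: contraNneq h2|apply: contraNneq h3] => <-.
split.
- by move=> s1 s2 e [Ds x0s]; split=> //; rewrite in_cons x0s orbT.
- move=> s1 s2 e us aK [Ds x0s]; left; split=> // x /Ds xs1.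
  by rewrite in_cons xs1 orbT.
- move=> s1 s2 e us [Ds x0s] nl; apply: (@no_copy_wasted t D) => //.
    by move: us; rewrite -cat_cons cat_uniq => /and3P [].
  by move=> x /Ds xs1; rewrite in_cons xs1 orbT.
move=> s1 s2 J us [Ds x0s] nl uJ sJ Jxs J1.
apply: (@perp_safe_wasted t c b J s1 s2 ht cb uJ sJ _ _ a D) => //.
- by move=> j jJ; have [] := nV _ (Jxs _ jJ); rewrite J1.
- by move: us; rewrite cat_uniq => /and3P [].
- by rewrite eq_sym.
- by apply/negP => /Jxs /nV [_]; rewrite eqxx.
move=> ga gc.
have [/hasP [j jJ nj]|/hasPn all] := boolP (has (fun j => tri c ga j \notin D) J).
  by exists j.
have {}all : {in J, forall j, tri c ga j \in D}.
  by move=> j /all; rewrite negbK.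
have [Ea|gaa] := eqVneq ga a.
  case: J uJ sJ Jxs J1 all => [|j J] _ /= sJ Jxs J1 all.
    by move: sJ; clear -ht; lia.
  have := nD _ (Jxs _ (mem_head _ _)); rewrite -Ea all //; exact: mem_head.
have /J1 /(uniq_disjoint us) : x0 \in J by apply: key gc gaa _ _ _ all.
by rewrite x0s.
Qed.

(** The lead is one to zero: all edges of P1 are in [Loc], and [b] is new to P2. *)
Lemma start_race t c a b xs s1 s2 Loc Bal x0 :
  uniq (c :: a :: b :: xs) -> size xs = (2 * t).-1 -> 0 < t ->
  {in xs, forall x, tri c a x \in s2} -> {in xs, forall x, ~~ Loc (tri c b x)} ->
  race_rules t c b xs Loc Bal -> x0 \in xs ->
  {in s2, forall e : {fset nat}, b \notin e} -> all Loc s1 ->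
  Bal s1 (tri c b x0 :: s2) -> racing t s1 (tri c b x0 :: s2).
Proof.
move=> uV sxs t0 Ha nL rr x0x bs2 Ls1 bal; exists c, a, b, xs, Loc, Bal.
have E : count (fun x => tri c b x \in tri c b x0 :: s2) xs = 1.
  have uxs : uniq xs by move: uV => /= /and4P [].
  transitivity (count (pred1 x0) xs); last by rewrite count_uniq_mem // x0x.
  apply: eq_in_count => x xx; rewrite in_cons.
  have -> : (tri c b x \in s2) = false.
    by apply/negP => /bs2; rewrite in_tri eqxx orbT.
  rewrite orbF; apply/eqP/eqP => [/tri_inj|-> //]; apply.
    by move: uV; rewrite /= !inE !negb_or => /andP [/and3P [_ _ h] _]; apply: contraNneq h => <-.
  by move: uV => /= /and4P [_ _ h _]; apply: contraNneq h => <-.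
split; split=> //; first by move=> x /Ha h; rewrite in_cons h orbT.
  by rewrite E.
rewrite E ltnS leqn0; apply/eqP/eqP; rewrite -leqn0 leqNgt -has_count.
by apply/negP => /hasP [e /(allP Ls1) /= ->].
Qed.

(** * The choice of the centre once P1 owns [2t] edges *)

Section StartRace.
Variables (t p q : nat) (xs : seq nat) (e0 : {fset nat}) (D s2 : seq {fset nat}).
Hypotheses (ht : 3 <= t) (uV : uniq (p :: q :: xs)) (sxs : size xs = (2 * t).-1).
Hypotheses (e0D : e0 \in D) (Ve0 : {in p :: q :: xs, forall x, x \notin e0}).
Hypothesis Hs2 : {in xs, forall x, tri p q x \in s2}.
Hypotheses (us : uniq (D ++ s2)) (KD : all K_aleph0_3 D) (sD : size D = 2 * t).

Let uD : uniq D.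
Proof. by move: us; rewrite cat_uniq => /and3P []. Qed.

Let exists_leaf : exists x, x \in xs.
Proof.
by case: (xs) sxs => [/= h|x r _]; [move: h; clear -ht; lia|exists x; rewrite mem_head].
Qed.

(* Both ends of the pair [p], [q] are still available as the centre. *)
Let is_pair c a := [/\ uniq (c :: a :: xs), {in xs, forall x, tri c a x \in s2} &
  {in c :: a :: xs, forall x, x \notin e0}].

Let pair_pq : is_pair p q. Proof. by []. Qed.

Let pair_qp : is_pair q p.
Proof.
split.
- by move: uV; rewrite /= !inE !negb_or eq_sym => /and3P [/andP [-> ->] -> ->].
- by move=> x /Hs2; rewrite triCl.
- by move=> x xV; apply: Ve0; move: xV; rewrite !in_cons orbCA.
Qed.

Let fresh_facts c a (M : nat) : is_pair c a -> exists b, [/\ M < b,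
  uniq (c :: a :: b :: xs), {in D ++ s2, forall e : {fset nat}, b \notin e} &
  {in xs, forall x, K_aleph0_3 (tri c b x) /\ tri c b x \notin D ++ s2}].
Proof.
case=> uc Hc _; have [N HN] := edges_bounded (D ++ s2).
have [x0 x0x] := exists_leaf.
have ins2 e : e \in s2 -> e \in D ++ s2 by rewrite mem_cat => ->; rewrite orbT.
have xN x : x \in xs -> x < N.
  by move=> /Hc /ins2 /HN; apply; rewrite in_tri eqxx !orbT.
have cN : c < N by apply: (HN _ (ins2 _ (Hc _ x0x))); rewrite in_tri eqxx.
have aN : a < N by apply: (HN _ (ins2 _ (Hc _ x0x))); rewrite in_tri eqxx orbT.
have Nb x : x < N -> (x == N + M.+1) = false.
  by move=> h; rewrite ltn_eqF //; apply: leq_trans h (leq_addr _ _).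
have bx : N + M.+1 \notin xs by apply/negP => /xN; clear; lia.
exists (N + M.+1); split; first by clear; lia.
- by move: uc; rewrite /= !inE !negb_or !Nb // bx /= => /and3P [/andP [-> ->] -> ->].
- move=> e /HN h; apply/negP => /h; clear; lia.
move=> x xx; split.
  apply: card_tri; rewrite ?Nb //.
    by move: uc; rewrite /= !inE !negb_or => /andP [/andP [_ h] _]; apply: contraNneq h => ->.
  by rewrite eq_sym Nb // xN.
apply/negP => /HN /(_ (N + M.+1)); rewrite in_tri eqxx orbT => /(_ isT); clear; lia.
Qed.

Lemma start_race_local k u v : u != k -> v != k -> u != v -> all (loc k u v) D ->
  exists e', [/\ K_aleph0_3 e', e' \notin D ++ s2 & racing t D (e' :: s2)].
Proof.
move=> uk vk uv LD.
have /andP [ke0 uve0] : loc k u v e0 by move/allP: LD; apply.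
(* [p] and [q] avoid [e0], which contains one of [u], [v]; so at most one of [p], [q] is in
   [{u,v}]. *)
have [c [a [cc cuv]]] : exists c a, is_pair c a /\ c \notin [:: u; v].
  case: (boolP (p \in [:: u; v])) => puv; last by exists p, q.
  exists q, p; split=> //.
  have pe0 : p \notin e0 by apply: Ve0; rewrite mem_head.
  have qe0 : q \notin e0 by apply: Ve0; rewrite !inE eqxx orbT.
  have pq : p != q by move: uV; rewrite /= !inE !negb_or => /andP [/andP []].
  apply/negP; move: puv uve0; rewrite !inE => /orP [] /eqP Ep /[swap] /orP [] /eqP Eq;
    by move: pq pe0 qe0; rewrite Ep Eq ?eqxx // => _ /negPf -> /negPf ->.
have [uc Hc ce0] := cc.
have ck : c != k by apply: contraTneq ke0 => <-; apply: ce0; rewrite mem_head.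
have kxs : k \notin xs.
  by apply/negP => kx; have := ce0 k; rewrite ke0 !inE kx !orbT => /(_ isT).
have [b [Mb ub bs bx]] := fresh_facts (k + u + v) cc.
have [x0 x0x] := exists_leaf; have [K0 n0] := bx _ x0x.
exists (tri c b x0); split=> //.
have [ca [cb [cxs bxs]]] : c != a /\ c != b /\ c \notin xs /\ b \notin xs.
  by move: ub; rewrite /= !inE !negb_or => /and4P [/and3P [-> -> ->] /andP [_ _] -> _].
have bT : b \notin [:: k; u; v].
  rewrite !inE !negb_or; apply/and3P; split; apply/eqP => E; move: Mb; rewrite E; clear; lia.
have cT : c \notin [:: k; u; v] by rewrite in_cons negb_or ck.
have rr := race_rules_local ht uk vk uv cT bT cb cxs bxs kxs ke0.
apply: (start_race ub sxs _ Hc _ rr x0x _ LD).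
- by clear -ht; lia.
- move=> x xx; rewrite /loc in_tri ![k == _]eq_sym (negPf ck).
  have -> : (b == k) = false by move: bT; rewrite !inE !negb_or => /and3P [/negPf].
  by have -> : (x == k) = false by apply: contraNF kxs => /eqP <-.
- by move=> e es; apply: bs; rewrite mem_cat es orbT.
(* The potential counts some of the [2t] edges of [D], so it starts within its bound. *)
split=> //; apply: (leq_trans (potential_anti _ _ _ _ _ _)).
by rewrite -sD; apply: count_size.
Qed.

Lemma start_race_wasted :
  (forall z al be, z != al -> z != be -> al != be ->
     exists2 e, e \in D & ~~ loc z al be e) ->
  exists e', [/\ K_aleph0_3 e', e' \notin D ++ s2 & racing t D (e' :: s2)].
Proof.
move=> wasted.
pose only c a (e : {fset nat}) := (c \in e) && (a \notin e).
have [c [a [cc cD]]] : exists c a, is_pair c a /\ count (only c a) D <= t.-1.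
  have pe0 : p \notin e0 by apply: Ve0; rewrite mem_head.
  have qe0 : q \notin e0 by apply: Ve0; rewrite !inE eqxx orbT.
  (* The two counts concern disjoint sets of edges, neither containing [e0]; their sum is at most
     [2t - 1], so one is at most [t.-1]. *)
  have sum : count (only p q) D + count (only q p) D < size D.
    rewrite -count_predUI (_ : count (predI _ _) D = 0); last first.
      apply/eqP; rewrite -leqn0 leqNgt -has_count; apply/negP => /hasP [e _] /=.
      by rewrite /only => /andP [/andP [-> _] /andP [_]].
    rewrite addn0 -(count_predC (predU (only p q) (only q p)) D) -[X in X < _]addn0 ltn_add2l.
    rewrite -has_count; apply/hasP; exists e0 => //=.
    by rewrite /only (negPf pe0) (negPf qe0).
  have [h|h] := leqP (count (only p q) D) t.-1; first by exists p, q.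
  exists q, p; split=> //; move: sum h; rewrite sD.
  by move: (count _ _) (count _ _); clear -ht; lia.
have [uc Hc ce0] := cc.
have [b [_ ub bs bx]] := fresh_facts 0 cc.
have [ca [cxs axs]] : c != a /\ c \notin xs /\ a \notin xs.
  by move: uc; rewrite /= !inE !negb_or => /and3P [/andP [-> ->] -> _].
have bD : {in D, forall e : {fset nat}, b \notin e}.
  by move=> e eD; apply: bs; rewrite mem_cat eD.
have sx0 : 0 < size xs by rewrite sxs; clear -ht; lia.
have ac : a != c by rewrite eq_sym.
have [x0 x0x key] := exists_key_leaf ht sx0 uD KD cxs axs ac cD.
have [K0 n0] := bx _ x0x; exists (tri c b x0); split=> //.
have nD : {in xs, forall x, tri c a x \notin D}.
  by move=> x /Hc h; apply/negP => /(uniq_disjoint us); rewrite h.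
have rr := race_rules_wasted ht ub uD sD bD wasted cD nD key.
apply: (start_race ub sxs _ Hc _ rr x0x) => //.
- by clear -ht; lia.
- by move=> x xx; apply/negP => /bD; rewrite in_tri eqxx orbT.
- by move=> e es; apply: bs; rewrite mem_cat es orbT.
by split=> //; rewrite mem_head.
Qed.

End StartRace.

(** * The opening, and the assembly of the phases *)

Definition opening t (s1 s2 : seq {fset nat}) := exists p q xs (e0 : {fset nat}),
  [/\ uniq (p :: q :: xs), size xs = size s1, size s1 < 2 * t, e0 \in s1 &
      {in p :: q :: xs, forall x, x \notin e0}] /\
  {in xs, forall x, tri p q x \in s2}.

Lemma no_copy_small t s : 3 <= t -> size s <= 2 * t -> ~ copy t s.
Proof.
move=> ht ss [z [al [be [X [L cp]]]]].
have := uniq_leq_size (copy_edges_uniq cp) (copy_edges_sub cp).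
rewrite (size_copy_edges ht cp) => h; have := leq_trans h ss; clear -ht; lia.
Qed.

Lemma opening_step t s1 s2 e : 3 <= t -> opening t s1 s2 -> uniq (e :: s1 ++ s2) ->
  all K_aleph0_3 (e :: s1 ++ s2) ->
  ~ copy t (e :: s1) /\
  exists e', [/\ K_aleph0_3 e', e' \notin e :: s1 ++ s2 &
    opening t (e :: s1) (e' :: s2) \/ racing t (e :: s1) (e' :: s2)].
Proof.
move=> ht [p [q [xs [e0 [[uV sxs st e01 Ve0] Hs2]]]]] us aK.
split; first exact: no_copy_small.
have e0D : e0 \in e :: s1 by rewrite in_cons e01 orbT.
(* The star grows by a fresh leaf until P1 owns [2t] edges; P2 then has [2t - 1] leaves and starts
   the race. *)
have [lt|ge] := ltnP (size s1).+1 (2 * t).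
  have [N HN] := edges_bounded (e :: s1 ++ s2).
  have ins1 x : x \in e :: s1 -> x \in e :: s1 ++ s2 by rewrite (mem_cat _ (e :: s1)) => ->.
  have ins2 x : x \in s2 -> x \in e :: s1 ++ s2 by rewrite (mem_cat _ (e :: s1)) => ->; rewrite orbT.
  have [x0 x0x] : exists x, x \in xs.
    by case: (xs) sxs => [/= h|x r _]; [move: e01; case: (s1) h|exists x; rewrite mem_head].
  have xN x : x \in p :: q :: xs -> x < N.
    rewrite !in_cons => /or3P [/eqP ->|/eqP ->|/Hs2 h].
    - by apply: (HN _ (ins2 _ (Hs2 _ x0x))); rewrite in_tri eqxx.
    - by apply: (HN _ (ins2 _ (Hs2 _ x0x))); rewrite in_tri eqxx orbT.
    - by apply: (HN _ (ins2 _ h)); rewrite in_tri eqxx !orbT.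
  have NV : N \notin p :: q :: xs by apply/negP => /xN; rewrite ltnn.
  have pq : p != q by move: uV; rewrite /= !inE !negb_or => /andP [/andP []].
  have [Np [Nq Nx]] : N != p /\ N != q /\ N \notin xs.
    by move: NV; rewrite !inE !negb_or => /and3P [-> -> ->].
  exists (tri p q N); split.
  - by apply: card_tri; rewrite // eq_sym.
  - by apply/negP => /HN /(_ N); rewrite in_tri eqxx !orbT ltnn => /(_ isT).
  left; exists p, q, (N :: xs), e0; split; first split=> //.
  - move: uV; rewrite /= !inE !negb_or ![_ == N]eq_sym Np Nq Nx.
    by case/and3P=> /andP [-> ->] -> ->.
  - by rewrite /= sxs.
  - move=> x; rewrite !in_cons => H; have [->|xV] := eqVneq x N.
      by apply/negP => /(HN _ (ins1 _ e0D)); rewrite ltnn.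
    by apply: Ve0; move: H; rewrite (negPf xV) !in_cons.
  - move=> x; rewrite !in_cons => /orP [/eqP ->|/Hs2 h]; first by rewrite eqxx.
    by rewrite h orbT.
have sD : size (e :: s1) = 2 * t by apply/eqP; rewrite eqn_leq ge andbT.
have sxs' : size xs = (2 * t).-1 by rewrite sxs -sD.
have us' : uniq ((e :: s1) ++ s2) by [].
have KD : all K_aleph0_3 (e :: s1) by move: aK; rewrite -cat_cons all_cat => /andP [].
have fin : (exists e', [/\ K_aleph0_3 e', e' \notin (e :: s1) ++ s2 & racing t (e :: s1) (e' :: s2)]) ->
   exists e', [/\ K_aleph0_3 e', e' \notin e :: s1 ++ s2 &
    opening t (e :: s1) (e' :: s2) \/ racing t (e :: s1) (e' :: s2)].
  by case=> e' [h1 h2 h3]; exists e'; split=> //; right.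
apply: fin.
(* If no triple makes all edges of P1 local, every choice of roles wastes one of them. *)
case: (classic (exists k u v, [/\ u != k, v != k, u != v & all (loc k u v) (e :: s1)])).
  case=> k [u [v [uk vk uv LD]]].
  exact (start_race_local ht uV sxs' e0D Ve0 Hs2 sD uk vk uv LD).
move=> no; apply: start_race_wasted ht uV sxs' e0D Ve0 Hs2 us' KD sD _.
move=> z al be zal zbe albe; apply/hasP; rewrite has_predC; apply/negP => LD.
by apply: no; exists z, al, be; rewrite ![_ == z]eq_sym.
Qed.

Lemma first_reply t e : 3 <= t -> K_aleph0_3 e ->
  exists e', [/\ K_aleph0_3 e', e' \notin [:: e] & opening t [:: e] [:: e']].
Proof.
move=> ht Ke; have [N HN] := edges_bounded [:: e].
have big x : N <= x -> x \notin e.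
  by move=> h; apply/negP => /(HN e (mem_head _ _)); rewrite ltnNge h.
exists (tri N N.+1 N.+2); split.
- by apply: card_tri; clear; lia.
- rewrite inE; apply/eqP => E; have := big N (leqnn _).
  by rewrite -E in_tri eqxx.
exists N, N.+1, [:: N.+2], e; split; first split.
- by rewrite /= !inE; clear; lia.
- by [].
- by rewrite /=; clear -ht; lia.
- exact: mem_head.
- by move=> x; rewrite !inE => /or3P [] /eqP ->; apply: big; clear; lia.
- by move=> x; rewrite inE => /eqP ->; rewrite mem_head.
Qed.

Theorem theorem4p2 (t : nat) (ht : 3 <= t) :
  P2_prevents_P1 K_aleph0_3 (cone3 (K2ts_edges t.+1 (t - 2))).
Proof.
apply: (@P2_prevents_P1_of_invariant t (fun s1 s2 =>
  [\/ s1 = [::] /\ s2 = [::], opening t s1 s2, racing t s1 s2 | perpetual t s1 s2])) => //.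
  by constructor 1.
move=> s1 s2 e [[-> ->]|op|ra|pe] us aK.
- have [|e' [K' n' op]] := @first_reply t e ht; first by move: aK => /= /andP [].
  split; first by apply: no_copy_small => //=; clear -ht; lia.
  by exists e'; split=> //; left; constructor 2.
- have [nc [e' [K' n' H]]] := opening_step ht op us aK; split=> //; exists e'; split=> //.
  by left; case: H => h; [constructor 2|constructor 3].
- have [nc [e' [K' n' H]]] := racing_step ht ra us aK; split=> //; exists e'; split=> //.
  by case: H => h; [left; constructor 3|left; constructor 4|right].
- have t0 : 0 < t by clear -ht; lia.
  have [nc [e' [K' n' H]]] := perpetual_step t0 pe us; split=> //; exists e'; split=> //.
  by case: H => h; [left; constructor 4|right].
Qed.
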